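(* Let $\Lambda$ and $\Gamma$ be countable discrete groups. Suppose that $\Lambda$ is non-amenable and bi-exact and that $\Lambda \hookrightarrow \Gamma$ is an existential embedding, and identify $\Lambda$ with its image in $\Gamma$. Then: (1) $\Lambda$ is strongly self-commensurating within $\Gamma$; that is, for every $g \in \Gamma\setminus\Lambda$ the intersection $\Lambda \cap g\Lambda g^{-1}$ has infinite index in $\Lambda$. (2) $\Lambda$ is conjugacy representation rigid in the class of self-commensurating subgroups of $\Gamma$; that is, for every self-commensurating subgroup $\Lambda'$ of $\Gamma$, the quasi-regular representations $\lambda_{\Gamma/\Lambda}$ and $\lambda_{\Gamma/\Lambda'}$ are weakly equivalent if and only if $\Lambda$ and $\Lambda'$ are conjugate subgroups of $\Gamma$.
   Context: Existential embedding: an embedding of groups $H \hookrightarrow G$ is existential if for every existential first-order sentence $\phi$ in the language of groups with constants from $H$, i.e. every sentence of the form $\exists x_1 \cdots \exists x_n\, \psi(x_1,\dots,x_n)$ with $\psi$ a quantifier-free formula (a Boolean combination of equations between words in the variables, elements of $H$, and inverses), one has $G \models \phi$ if and only if $H \models \phi$. Bi-exact: a countable discrete group $\Lambda$ is bi-exact if the action of $\Lambda \times \Lambda$ by left/right translations, the continuous extension of $(s,t)\cdot x = s x t^{-1}$, on the Stone–Čech remainder $\partial^\beta \Lambda := \beta\Lambda \setminus \Lambda$ is (topologically) amenable. This means that there is a sequence of continuous maps $\mu^n : \partial^\beta\Lambda \to \mathrm{Prob}(\Lambda\times\Lambda)$, $x \mapsto \mu^n_x$, such that for every $s \in \Lambda\times\Lambda$,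 $$\lim_{n\to\infty} \sup_{x \in \partial^\beta\Lambda} \| s\cdot \mu^n_x - \mu^n_{s\cdot x}\|_1 = 0,$$ where $\mathrm{Prob}(\Lambda\times\Lambda) = \{\mu \in \ell^1(\Lambda\times\Lambda) : \mu \ge 0,\ \|\mu\|_1 = 1\}$ (with the topology of pointwise convergence, which agrees on this set with the $\ell^1$-norm topology) and $(s\cdot\mu)(t) = \mu(s^{-1}t)$. Self-commensurating: for a subgroup $\Lambda \le \Gamma$, the commensurator $\mathrm{Comm}_\Gamma(\Lambda)$ is the set of $g\in\Gamma$ such that $\Lambda \cap g\Lambda g^{-1}$ has finite index in both $\Lambda$ and $g\Lambda g^{-1}$. The subgroup $\Lambda$ is self-commensurating if $\mathrm{Comm}_\Gamma(\Lambda) = \Lambda$. Quasi-regular representation: $\lambda_{\Gamma/\Lambda}$ is the unitary representation of $\Gamma$ on $\ell^2(\Gamma/\Lambda)$ induced by the left multiplication action of $\Gamma$ on $\Gamma/\Lambda$. Weak equivalence: a unitary representation $\pi$ of $\Gamma$ is weakly contained in $\rho$ if $\|\pi(f)\| \le \|\rho(f)\|$ for all $f$ in the complex group algebra $\mathbb{C}[\Gamma]$; $\pi$ and $\rho$ are weakly equivalent if each is weakly contained in the other. *)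

(* Defs.v *)
From HB Require Import structures.
From mathcomp Require Import all_boot all_order all_algebra finmap.
From mathcomp Require Import all_classical all_reals all_analysis.
From mathcomp Require Import complex ring lra.

Set Implicit Arguments.
Unset Strict Implicit.
Unset Printing Implicit Defensive.

Import Order.TTheory GRing.Theory Num.Theory.
Import numFieldNormedType.Exports.

Local Open Scope classical_set_scope.
Local Open Scope ring_scope.

Section Subgroups.
Variable G : groupType.
Implicit Types (g : G) (H K : set G).

Definition subgroup H := group_closed (mem H).

Lemma subgroupP H :
  subgroup H <-> H 1%g /\ (forall x y, H x -> H y -> H (x / y)%g).
Proof.
split=> -[H1 HB]; split; [exact: set_mem| |exact: mem_set|].
  by move=> x y Hx Hy; apply: set_mem; apply: HB; exact: mem_set.
by move=> x y Hx Hy; apply: mem_set; apply: HB; exact: set_mem.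
Qed.

Definition lcoset g H : set G := [set (g * x)%g | x in H].

(* [g H g^-1]; MathComp's [x ^ y] is [y^-1 * x * y] *)
Definition lconj g H : set G := [set (g * x * g^-1)%g | x in H].

Definition conjugate H K := exists g, K = lconj g H.

(* [K] is meant to be a subgroup of [H] *)
Definition finite_index K H := finite_set [set lcoset h K | h in H].

Definition commensurator H : set G :=
  [set g | finite_index (H `&` lconj g H) H /\
           finite_index (H `&` lconj g H) (lconj g H)].

Definition self_commensurating H := commensurator H = H.

Definition strongly_self_commensurating H :=
  forall g, ~ H g -> ~ finite_index (H `&` lconj g H) H.

End Subgroups.

(* words over the variables ['I_n] and constants from [K]; as [K] will be a group,
   its unit is among the constants *)
Inductive word (K : Type) (n : nat) :=
| WVar of 'I_n
| WConst of K
| WMul of word K n & word K n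
| WInv of word K n.

Inductive qf_formula (K : Type) (n : nat) :=
| FEq of word K n & word K n
| FNot of qf_formula K n
| FAnd of qf_formula K n & qf_formula K n
| FOr of qf_formula K n & qf_formula K n.

Section Semantics.
Variables (K : Type) (G : groupType) (c : K -> G) (n : nat) (v : 'I_n -> G).

Fixpoint word_eval (w : word K n) : G :=
  match w with
  | WVar i => v i
  | WConst k => c k
  | WMul w1 w2 => (word_eval w1 * word_eval w2)%g
  | WInv w1 => ((word_eval w1)^-1)%g
  end.

Fixpoint qf_holds (f : qf_formula K n) : Prop :=
  match f with
  | FEq w1 w2 => word_eval w1 = word_eval w2
  | FNot f1 => ~ qf_holds f1
  | FAnd f1 f2 => qf_holds f1 /\ qf_holds f2
  | FOr f1 f2 => qf_holds f1 \/ qf_holds f2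
  end.

End Semantics.

(* [G |= exists x_1 ... x_n, psi], the constants being interpreted by [c] *)
Definition models_ex (K : Type) (G : groupType) (c : K -> G) (n : nat)
    (psi : qf_formula K n) : Prop :=
  exists v : 'I_n -> G, qf_holds c v psi.

Definition existential_embedding (H G : groupType)
    (iota : {multiplicative H -> G}) : Prop :=
  injective iota /\
  forall (n : nat) (psi : qf_formula H n),
    models_ex iota psi <-> models_ex (@idfun H) psi.

(* amenability as a discrete group: there is a left-invariant finitely additive
   probability measure on all subsets *)
Definition amenable (R : realType) (G : groupType) : Prop :=
  exists m : set G -> R,
    [/\ (forall A, 0 <= m A), m setT = 1,
        (forall A B, A `&` B = set0 -> m (A `|` B) = m A + m B) &
        (forall g A, m (lcoset g A) = m A)].

(* The Stone-Cech compactification of the discrete space [T] is realized as its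
   space of ultrafilters: compact, Hausdorff, containing [T] as a dense subset,
   with every [f : T -> U] extending continuously (lemmas below). *)

Record stoneCech (T : Type) := StoneCech {
  sc_filter : set_system T;
  sc_ultra : UltraFilter sc_filter }.

HB.instance Definition _ (T : Type) := gen_eqMixin (stoneCech T).
HB.instance Definition _ (T : Type) := gen_choiceMixin (stoneCech T).

Lemma stoneCechP T (U V : stoneCech T) : sc_filter U = sc_filter V -> U = V.
Proof.
case: U V => [U uU] [V uV] /= UV; move: uU; rewrite UV => uU.
by congr StoneCech; exact: Prop_irrelevance.
Qed.

(* the [sc_basic A], for [A : set T], form a base of the topology *)
Definition sc_basic T (A : set T) : set (stoneCech T) :=
  [set U | sc_filter U A].

Section Topology.
Variable T : Type.

Let cover : \bigcup_(A in [set: set T]) sc_basic A = setT.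
Proof.
rewrite -subTset => U _; have ? := sc_ultra U.
by exists setT => //; exact: filterT.
Qed.

Let join (A B : set T) (U : stoneCech T) :
  setT A -> setT B -> sc_basic A U -> sc_basic B U ->
  exists D, [/\ setT D, sc_basic D U & sc_basic D `<=` sc_basic A `&` sc_basic B].
Proof.
move=> _ _ UA UB; have ? := sc_ultra U; exists (A `&` B).
split=> // [|V VAB]; first exact: filterI.
have ? := sc_ultra V; split; apply: filterS VAB; [exact: subIsetl|exact: subIsetr].
Qed.

HB.instance Definition _ := @isBaseTopological.Build (stoneCech T)
  (set T) setT (@sc_basic T) cover join.

End Topology.

Definition sc_pure T (x : T) : stoneCech T :=
  StoneCech (principal_filter_ultra x).

Definition sc_remainder T : set (stoneCech T) := ~` range (@sc_pure T).

Lemma ultraFilterE (T : Type) (F : set_system T) :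
  ProperFilter F -> (forall A, F A \/ F (~` A)) -> UltraFilter F.
Proof.
move=> pF FAC; split=> // H HF FH; rewrite predeqE => A; split; last exact: FH.
have [//|/FH HnA HA] := FAC A; have : H (A `&` ~` A) by exact: filterI.
by rewrite setICr => /(@filter_not_empty _ _ _).
Qed.

Lemma ultra_fmap (T U : Type) (f : T -> U) (F : set_system T) :
  UltraFilter F -> UltraFilter (f @ F).
Proof.
move=> uF; have pF := @ultra_proper _ _ uF.
by apply: ultraFilterE => A; exact: (in_ultra_setVsetC (f @^-1` A) uF).
Qed.

(* the continuous extension of [f : T -> U], i.e. the pushforward of ultrafilters;
   see [sc_map_pure] and [sc_map_continuous] *)
Definition sc_map (T U : Type) (f : T -> U) (x : stoneCech T) : stoneCech U :=
  StoneCech (ultra_fmap f (sc_ultra x)).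

Lemma sc_map_pure (T U : Type) (f : T -> U) (t : T) :
  sc_map f (sc_pure t) = sc_pure (f t).
Proof.
apply: stoneCechP => /=; rewrite predeqE => A.
by split=> /principal_filterP At; apply/principal_filterP.
Qed.

Lemma open_sc_basic T (A : set T) : open (sc_basic A).
Proof. by exists [set A] => //; rewrite bigcup_set1. Qed.

Lemma sc_map_continuous (T U : Type) (f : T -> U) : continuous (sc_map f).
Proof.
apply/continuousP => _ [D _ <-]; rewrite preimage_bigcup.
by apply: bigcup_open => A _; exact: (open_sc_basic (f @^-1` A)).
Qed.

Lemma sc_pure_dense T : dense (range (@sc_pure T)).
Proof.
move=> O [U OU] [D _ DO]; move: OU; rewrite -DO => -[A DA UA].
have ? := sc_ultra U; have [t At] := filter_ex UA.
exists (sc_pure t); split; last by exists t.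
by exists A => //; exact/principal_filterP.
Qed.

Lemma sc_basicC T (A : set T) : sc_basic (~` A) = ~` sc_basic A.
Proof.
rewrite predeqE => U; have ? := sc_ultra U; split=> [UnA UA|nUA].
  have : sc_filter U (A `&` ~` A) by exact: filterI.
  by rewrite setICr => /(@filter_not_empty _ _ _).
by have [|//] := in_ultra_setVsetC A (sc_ultra U).
Qed.

Lemma sc_hausdorff T : hausdorff_space (stoneCech T).
Proof.
rewrite open_hausdorff => U V /eqP UV.
have [A [UA VA]] : exists A, sc_basic A U /\ sc_basic (~` A) V.
  apply: contrapT => nUV; apply: UV; apply: stoneCechP.
  have ? := sc_ultra U; have ? := sc_ultra V.
  apply/esym; apply: (max_filter (F := sc_filter U)) => A UA.
  by have [//|VA] := in_ultra_setVsetC A (sc_ultra V); case: nUV; exists A.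
exists (sc_basic A, sc_basic (~` A)); first by rewrite !inE.
split; [exact: open_sc_basic|exact: open_sc_basic|].
by rewrite sc_basicC setICr.
Qed.

Lemma sc_compact T : compact [set: stoneCech T].
Proof.
rewrite compact_ultra => F uF _; have pF := @ultra_proper _ _ uF.
pose U : set_system T := [set A | F (sc_basic A)].
have pU : ProperFilter U.
  split; first by rewrite /U/= (_ : sc_basic set0 = set0);
    [exact: filter_not_empty|rewrite -setCT sc_basicC -subset0 => V; apply;
     have ? := sc_ultra V; exact: filterT].
  split=> [|A B UA UB|A B AB]; rewrite /U/=.
  - apply: (@filterS _ F) filterT => V _.
    by have ? := sc_ultra V; exact: (@filterT _ (sc_filter V)).
  - apply: (@filterS _ F) (@filterI _ F _ _ _ UA UB) => V [VA VB].
    by have ? := sc_ultra V; exact: (@filterI _ (sc_filter V)).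
  - apply: (@filterS _ F) => V.
    by have ? := sc_ultra V; exact: (@filterS _ (sc_filter V)).
have uU : UltraFilter U.
  apply: ultraFilterE => A; rewrite /U/= sc_basicC.
  exact: in_ultra_setVsetC.
exists (StoneCech uU); split=> // B; rewrite nbhsE => -[W [[D _ <-] [A DA FA]] WB].
by apply: (@filterS _ F) FA => V VA; apply: WB; exists A.
Qed.

Definition prob_measure (R : realType) (T : choiceType) : set (T -> R) :=
  [set m | (forall t, 0 <= m t) /\ \esum_(t in [set: T]) (m t)%:E = 1%E].

Definition l1norm (R : realType) (T : choiceType) (m : T -> R) : R :=
  fine (\esum_(t in [set: T]) `|m t|%:E).

Definition translate_measure (R : realType) (G : groupType) (s : G)
    (m : G -> R) : G -> R := fun t => m (s^-1 * t)%g.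

Definition bitranslate (G : groupType) (s : G * G) (x : G) : G :=
  (s.1 * x * s.2^-1)%g.

(* [mu n] is only constrained on the remainder. The suprema are over subsets of
   [0, 2]; when [G] is finite the remainder is empty and [sup set0 = 0]. *)
Definition bi_exact (R : realType) (G : groupType) : Prop :=
  exists mu : nat -> stoneCech G -> {ptws (G * G)%type -> R},
  [/\ forall n x, sc_remainder x -> prob_measure (mu n x),
      forall n, {within @sc_remainder G, continuous (mu n)} &
      forall s : (G * G)%type,
        (fun n => sup [set l1norm (translate_measure s (mu n x) \-
                                   mu n (sc_map (bitranslate s) x))
                      | x in @sc_remainder G]) @ \oo --> (0 : R)].

Section Sums.
Variables (R : realType) (X : choiceType).
Implicit Types (a b h : X -> R) (f g : X -> R[i]).

Definition nnsum a : \bar R := \esum_(x in [set: X]) (a x)%:E.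

Lemma nnsum_ge0 a : (forall x, 0 <= a x) -> (0 <= nnsum a)%E.
Proof. by move=> a0; apply: esum_ge0 => x _; rewrite lee_fin. Qed.

Lemma le_nnsum a b : (forall x, a x <= b x) -> (nnsum a <= nnsum b)%E.
Proof. by move=> ab; apply: le_esum => x _; rewrite lee_fin. Qed.

Lemma lt_nnsum a b : (forall x, a x <= b x) -> (nnsum b < +oo)%E ->
  (nnsum a < +oo)%E.
Proof. by move=> ab; apply: le_lt_trans; exact: le_nnsum. Qed.

Lemma nnsum_ge a x : (forall x, 0 <= a x) -> ((a x)%:E <= nnsum a)%E.
Proof.
move=> a0; rewrite -[leLHS](@esum_set1 R X x (EFin \o a)) ?lee_fin//.
rewrite /nnsum esum_mkcond; apply: le_esum => y _ /=.
by case: ifPn => _; rewrite lee_fin.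
Qed.

Lemma nnsum0 : nnsum (fun=> 0) = 0%E.
Proof. by rewrite /nnsum esum1. Qed.

Lemma nnsumD a b : (forall x, 0 <= a x) -> (forall x, 0 <= b x) ->
  nnsum (a \+ b) = (nnsum a + nnsum b)%E.
Proof. by move=> a0 b0; rewrite /nnsum -esumD// => x _; rewrite lee_fin. Qed.

Lemma nnsumZ (c : R) a : 0 <= c -> (forall x, 0 <= a x) ->
  nnsum (fun x => c * a x) = (c%:E * nnsum a)%E.
Proof.
rewrite le_eqVlt => /predU1P[<- _|c0 a0].
  by under eq_fun do rewrite mul0r; rewrite nnsum0 mul0e.
rewrite /nnsum /esum -ereal_sup_pZl// image_comp; congr ereal_sup.
apply: eq_imagel => A [finA _] /=.
by rewrite ge0_mule_fsumr.
Qed.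

Lemma nnsum_fin a : (forall x, 0 <= a x) -> (nnsum a < +oo)%E ->
  nnsum a \is a fin_num.
Proof. by move=> a0 aoo; rewrite ge0_fin_numE// nnsum_ge0. Qed.

(* meaningful for absolutely summable families only; likewise [csum] *)
Definition rsum h : R :=
  fine (nnsum (fun x => Num.max (h x) 0)%R) -
  fine (nnsum (fun x => Num.max (- h x) 0)%R).

Definition abs_summable h := (nnsum (fun x => `|h x|%R) < +oo)%E.

Lemma rsumE h a b : (forall x, 0 <= a x) -> (forall x, 0 <= b x) ->
  (nnsum a < +oo)%E -> (nnsum b < +oo)%E -> (forall x, h x = a x - b x) ->
  rsum h = fine (nnsum a) - fine (nnsum b).
Proof.
move=> a0 b0 aoo boo hE.
pose p x := Num.max (h x) 0; pose n x := Num.max (- h x) 0.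
have p0 x : 0 <= p x by rewrite le_max lexx orbT.
have n0 x : 0 <= n x by rewrite le_max lexx orbT.
have poo : (nnsum p < +oo)%E.
  by apply: lt_nnsum aoo => x; rewrite ge_max a0 hE lerBlDr lerDl b0.
have noo : (nnsum n < +oo)%E.
  by apply: lt_nnsum boo => x; rewrite ge_max b0 hE opprB lerBlDr lerDl a0.
have : (nnsum p + nnsum b = nnsum n + nnsum a)%E.
  rewrite -!nnsumD//; congr nnsum; apply/funext => x /=; rewrite /p /n hE.
  by rewrite /Num.max; case: ifPn; case: ifPn; lra.
rewrite -[in LHS](fineK (nnsum_fin p0 poo)) -(fineK (nnsum_fin b0 boo)).
rewrite -(fineK (nnsum_fin n0 noo)) -[X in _ = (_ + X)%E](fineK (nnsum_fin a0 aoo)).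
rewrite -!EFinD => -[]; rewrite /rsum -/p -/n; lra.
Qed.

Lemma rsum_split h : abs_summable h -> exists a b,
  [/\ (forall x, 0 <= a x) /\ (forall x, 0 <= b x),
     (nnsum a < +oo)%E /\ (nnsum b < +oo)%E & forall x, h x = a x - b x].
Proof.
move=> hs; exists (fun x => Num.max (h x) 0), (fun x => Num.max (- h x) 0).
split; [by split => x; rewrite le_max lexx orbT| |].
  by split; apply: lt_nnsum hs => x; rewrite ge_max normr_ge0 andbT -?[- h x]normrN ?ler_norm// -normrN ler_norm.
by move=> x; rewrite /Num.max; case: ifPn; case: ifPn; lra.
Qed.

Lemma rsumD h1 h2 : abs_summable h1 -> abs_summable h2 ->
  rsum (fun x => h1 x + h2 x) = rsum h1 + rsum h2.
Proof.
move=> /rsum_split[a1 [b1 [[a10 b10] [a1f b1f] e1]]].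
move=> /rsum_split[a2 [b2 [[a20 b20] [a2f b2f] e2]]].
rewrite (@rsumE h1 a1 b1)// (@rsumE h2 a2 b2)//.
rewrite (@rsumE _ (a1 \+ a2) (b1 \+ b2)) ?nnsumD ?lte_add_pinfty//.
- by rewrite !fineD ?nnsum_fin//; lra.
- by move=> x; rewrite addr_ge0.
- by move=> x; rewrite addr_ge0.
- by move=> x /=; rewrite e1 e2; lra.
Qed.

Lemma rsumN h : abs_summable h -> rsum (fun x => - h x) = - rsum h.
Proof.
move=> /rsum_split[a [b [[a0 b0] [af bf] e]]].
rewrite (@rsumE h a b)// (@rsumE _ b a)// ?opprB// => x.
by rewrite e opprB.
Qed.

Lemma abs_summableZ c h : abs_summable h -> abs_summable (fun x => c * h x).
Proof.
rewrite /abs_summable => hs; under eq_fun do rewrite normrM.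
by rewrite nnsumZ// lte_mul_pinfty// nnsum_fin.
Qed.

Lemma abs_summableD h1 h2 : abs_summable h1 -> abs_summable h2 ->
  abs_summable (fun x => h1 x + h2 x).
Proof.
move=> s1 s2; apply: (@lt_nnsum _ ((fun x => `|h1 x|) \+ (fun x => `|h2 x|))).
  by move=> x; exact: ler_normD.
by rewrite nnsumD// lte_add_pinfty.
Qed.

Lemma rsumZ c h : abs_summable h -> rsum (fun x => c * h x) = c * rsum h.
Proof.
wlog c0 : c / 0 <= c => [H hs|].
  have [c0|c0] := leP 0 c; first exact: H.
  rewrite -[c]opprK [in RHS]mulNr -H//; last by rewrite oppr_ge0 ltW.
  rewrite -rsumN; last exact: abs_summableZ.
  by congr rsum; apply/funext => x; rewrite mulNr.
move=> /rsum_split[a [b [[a0 b0] [af bf] e]]].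
rewrite (@rsumE h a b)//.
rewrite (@rsumE _ (fun x => c * a x) (fun x => c * b x)) ?nnsumZ//.
- by rewrite !fineM ?nnsum_fin// mulrBr.
- by move=> x; rewrite mulr_ge0.
- by move=> x; rewrite mulr_ge0.
- by rewrite lte_mul_pinfty// nnsum_fin.
- by rewrite lte_mul_pinfty// nnsum_fin.
- by move=> x; rewrite e mulrBr.
Qed.

Lemma ge0_rsum a : (forall x, 0 <= a x) -> (nnsum a < +oo)%E ->
  rsum a = fine (nnsum a).
Proof.
move=> a0 af; rewrite (@rsumE _ a (fun=> 0)) ?nnsum0//= ?subr0// => x.
by rewrite subr0.
Qed.

Definition csum f : R[i] :=
  Complex (rsum (fun x => complex.Re (f x))) (rsum (fun x => complex.Im (f x))).

Definition cabs_summable f :=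
  abs_summable (fun x => complex.Re (f x)) /\
  abs_summable (fun x => complex.Im (f x)).

Lemma csumD f g : cabs_summable f -> cabs_summable g ->
  csum (fun x => f x + g x) = csum f + csum g.
Proof.
move=> [f1 f2] [g1 g2]; apply/eqP; rewrite eq_complex /= -!rsumD//.
by apply/andP; split; apply/eqP; congr rsum; apply/funext => x;
  case: (f x) (g x) => ? ? [].
Qed.

Lemma csumZ c f : cabs_summable f -> csum (fun x => c * f x) = c * csum f.
Proof.
case: c => [c d] [f1 f2]; apply/eqP; rewrite eq_complex /= -mulNr -!rsumZ//.
rewrite -!rsumD//; try exact: abs_summableZ.
by apply/andP; split; apply/eqP; congr rsum; apply/funext => x;
  case: (f x) => ? ? /=; rewrite ?mulNr.
Qed.

Lemma csum_conj f : cabs_summable f ->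
  csum (fun x => (f x)^*%C) = (csum f)^*%C.
Proof.
move=> [f1 f2]; apply/eqP; rewrite eq_complex /= -!rsumN//.
by apply/andP; split; apply/eqP; congr rsum; apply/funext => x; case: (f x).
Qed.

End Sums.

Definition ip_norm (R : realType) (V : lmodType R[i])
    (ip : {dot V for @conjc R}) (v : V) : R :=
  Num.sqrt (complex.Re (ip v v)).

Record hilbert (R : realType) := Hilbert {
  hvec :> lmodType R[i];
  hip : {dot hvec for @conjc R};
  hcomplete : forall u : nat -> hvec,
    (forall e : R, 0 < e -> exists N, forall m n, (N <= m)%N -> (N <= n)%N ->
       ip_norm hip (u m - u n) < e) ->
    exists l, (fun n => ip_norm hip (u n - l)) @ \oo --> (0 : R) }.

Definition hnorm (R : realType) (H : hilbert R) : H -> R := ip_norm (hip H).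

Section Ell2.
Variables (R : realType) (X : choiceType).

(* the squared modulus, see [add_Re2_Im2] *)
Definition sqmod (z : R[i]) : R := complex.Re z ^+ 2 + complex.Im z ^+ 2.

Lemma sqmod_ge0 z : 0 <= sqmod z.
Proof. by rewrite addr_ge0 ?sqr_ge0. Qed.

Lemma sqmod_eq0 z : sqmod z = 0 -> z = 0.
Proof.
case: z => a b /eqP; rewrite /sqmod/= paddr_eq0 ?sqr_ge0// !sqrf_eq0.
by move=> /andP[/eqP-> /eqP->].
Qed.

Lemma sqmodM z w : sqmod (z * w) = sqmod z * sqmod w.
Proof. by case: z w => a b [c d]; rewrite /sqmod/=; ring. Qed.

Lemma sqmodD z w : sqmod (z + w) <= 2 * (sqmod z + sqmod w).
Proof.
case: z w => a b [c d]; rewrite /sqmod/=.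
have := sqr_ge0 (a - c); have := sqr_ge0 (b - d); nra.
Qed.

Lemma sqmodN z : sqmod (- z) = sqmod z.
Proof. by case: z => a b; rewrite /sqmod/= !sqrrN. Qed.

Definition square_summable : {pred X -> R[i]} :=
  fun f => `[< (nnsum (fun x => sqmod (f x)) < +oo)%E >].

Lemma square_summable_submod : submod_closed square_summable.
Proof.
split=> [|c f g /asboolP fs /asboolP gs]; apply/asboolP.
  rewrite (_ : nnsum _ = 0%E)// -[RHS](nnsum0 R X); congr nnsum.
  by apply/funext => x; rewrite /sqmod/= expr0n/= addr0.
apply: (@lt_nnsum _ _ _ ((fun x => 2 * sqmod c * sqmod (f x)) \+
                         (fun x => 2 * sqmod (g x)))).
  by move=> x; rewrite /= -mulrA -mulrDr -sqmodM; exact: sqmodD.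
rewrite nnsumD => [|x|x].
- have c0 : 0 <= 2 * sqmod c by rewrite mulr_ge0 ?sqmod_ge0.
  by rewrite !nnsumZ ?lte_add_pinfty ?lte_mul_pinfty ?nnsum_fin ?lee_fin// => x;
    exact: sqmod_ge0.
- by rewrite !mulr_ge0 ?sqmod_ge0.
- by rewrite !mulr_ge0 ?sqmod_ge0.
Qed.

HB.instance Definition _ :=
  GRing.isSubmodClosed.Build R[i] (X -> R[i]) square_summable
    square_summable_submod.

Record ell2 := Ell2 {
  ell2_fun :> X -> R[i];
  ell2P : ell2_fun \in square_summable }.

HB.instance Definition _ := [isSub for ell2_fun].
HB.instance Definition _ := [Choice of ell2 by <:].
HB.instance Definition _ := [SubChoice_isSubLmodule of ell2 by <:].

Lemma ell2_lt (f : ell2) : (nnsum (fun x => sqmod (f x)) < +oo)%E.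
Proof. by apply/asboolP; exact: ell2P. Qed.

Lemma ell2D (f g : ell2) x : (f + g) x = f x + g x. Proof. by []. Qed.
Lemma ell2N (f : ell2) x : (- f) x = - f x. Proof. by []. Qed.
Lemma ell2Z c (f : ell2) x : (c *: f) x = c * f x. Proof. by []. Qed.

Definition ell2_ip (f g : ell2) : R[i] := csum (fun x => f x * (g x)^*%C).

Lemma ell2_ip_summable (f g : ell2) : cabs_summable (fun x => f x * (g x)^*%C).
Proof.
have s : (nnsum ((fun x => sqmod (f x)) \+ (fun x => sqmod (g x)))%R < +oo)%E.
  by rewrite nnsumD ?lte_add_pinfty ?ell2_lt// => x; exact: sqmod_ge0.
split; apply: lt_nnsum s => x; rewrite /sqmod/=;
  case: (f x) (g x) => a b [c d] /=; rewrite ler_norml; apply/andP; split;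
  have := sqr_ge0 (a + c); have := sqr_ge0 (a - c);
  have := sqr_ge0 (b + d); have := sqr_ge0 (b - d);
  have := sqr_ge0 (a + d); have := sqr_ge0 (a - d);
  have := sqr_ge0 (b + c); have := sqr_ge0 (b - c);
  have := sqr_ge0 a; have := sqr_ge0 b; have := sqr_ge0 c; have := sqr_ge0 d;
  rewrite !expr2; lra.
Qed.

Lemma ell2_ipE (f : ell2) :
  ell2_ip f f = Complex (fine (nnsum (fun x => sqmod (f x)))) 0.
Proof.
have reE x : complex.Re (f x * (f x)^*%C) = sqmod (f x).
  by case: (f x) => a b; rewrite /sqmod/=; ring.
have imE x : complex.Im (f x * (f x)^*%C) = 0.
  by case: (f x) => a b; rewrite /=; ring.
rewrite /ell2_ip /csum; under eq_fun do rewrite reE.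
under [X in Complex _ (rsum X)]eq_fun do rewrite imE.
rewrite !ge0_rsum ?nnsum0// ?ell2_lt// => x; exact: sqmod_ge0.
Qed.

Let ell2_ip_linearl (g : ell2) : linear_for *%R (ell2_ip^~ g).
Proof.
move=> c f1 f2.
have E1 := csumZ c (ell2_ip_summable f1 g).
have s1 : cabs_summable (fun x => c * (f1 x * (g x)^*%C)).
  have := ell2_ip_summable (c *: f1) g.
  by under eq_fun do rewrite ell2Z -mulrA.
have E2 := csumD s1 (ell2_ip_summable f2 g).
rewrite /ell2_ip -E1 -E2; congr csum; apply/funext => x.
by rewrite ell2D ell2Z mulrDl mulrA.
Qed.

Let ell2_ipC (f g : ell2) : ell2_ip f g = (ell2_ip g f)^*%C.
Proof.
rewrite /ell2_ip -csum_conj; last exact: ell2_ip_summable.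
congr csum; apply/funext => x.
case: (f x) (g x) => a b [c d] /=; congr Complex; ring.
Qed.

Let ell2_ip_linearr (f : ell2) : linear_for (@conjc R \; *%R) (ell2_ip f).
Proof.
move=> c g1 g2; rewrite ell2_ipC ell2_ip_linearl rmorphD rmorphM /=.
by rewrite [in RHS]ell2_ipC [ell2_ip f g2]ell2_ipC.
Qed.

HB.instance Definition _ := bilinear_isBilinear.Build R[i] ell2 ell2 R[i]
  *%R (@conjc R \; *%R) ell2_ip (ell2_ip_linearl, ell2_ip_linearr).

Let ell2_ip_hermitian (f g : ell2) :
  ell2_ip f g = (-1) ^+ false * (ell2_ip g f)^*%C.
Proof. by rewrite expr0 mul1r -ell2_ipC. Qed.

HB.instance Definition _ := isHermitianSesquilinear.Build R[i] ell2
  false (@conjc R) ell2_ip ell2_ip_hermitian.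

Let ell2_ip_gt0 (f : ell2) : f != 0 -> 0 < ell2_ip f f.
Proof.
move=> f0; have [x fx] : exists x, f x != 0.
  apply: contrapT => nf; case/eqP: f0; apply/val_inj/funext => x /=.
  by apply: contrapT => /eqP fx; apply: nf; exists x.
rewrite ell2_ipE ltcE/= eqxx/= -lte_fin fineK; last first.
  by rewrite nnsum_fin ?ell2_lt// => y; exact: sqmod_ge0.
apply: (@lt_le_trans _ _ (sqmod (f x))%:E); last first.
  by apply: (@nnsum_ge _ _ (fun x => sqmod (f x))) => y; exact: sqmod_ge0.
rewrite lte_fin lt_neqAle sqmod_ge0 andbT eq_sym; apply: contra fx.
by move=> /eqP /sqmod_eq0 ->.
Qed.

HB.instance Definition _ := isDotProduct.Build R[i] ell2 ell2_ip ell2_ip_gt0.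

Lemma ell2_normE (f : ell2) :
  ip_norm ell2_ip f = Num.sqrt (fine (nnsum (fun x => sqmod (f x)))).
Proof. exact: (congr1 (fun z => Num.sqrt (complex.Re z)) (ell2_ipE f)). Qed.

Let real_cauchy (v : nat -> R) :
  (forall e, 0 < e -> exists N, forall m n, (N <= m)%N -> (N <= n)%N ->
     `|v m - v n| < e) -> exists l : R, v @ \oo --> l.
Proof.
move=> vC; suff : cvg (v @ \oo) by exists (lim (v @ \oo)).
apply/cauchy_cvgP/cauchy_exP => e /vC[N vN]; exists (v N).
by exists N => // n /= Nn; exact: vN.
Qed.

Let ell2_complete (u : nat -> ell2) :
  (forall e : R, 0 < e -> exists N, forall m n, (N <= m)%N -> (N <= n)%N ->
     ip_norm ell2_ip (u m - u n) < e) ->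
  exists l, (fun n => ip_norm ell2_ip (u n - l)) @ \oo --> (0 : R).
Proof.
move=> uC.
have sq0 (f : ell2) x : 0 <= sqmod (f x) by exact: sqmod_ge0.
have fK (f : ell2) : (fine (nnsum (fun x => sqmod (f x))))%:E =
    nnsum (fun x => sqmod (f x)).
  by rewrite fineK// nnsum_fin ?ell2_lt.
have uC2 (e : R) : 0 < e -> exists N, forall m n, (N <= m)%N -> (N <= n)%N ->
    (nnsum (fun x => sqmod ((u m - u n) x))%R < e%:E)%E.
  move=> e0; have [|N uN] := uC (Num.sqrt e); first by rewrite sqrtr_gt0.
  exists N => m n Nm Nn; have := uN m n Nm Nn.
  by rewrite ell2_normE ltr_sqrt// -fK lte_fin.
have uC3 (e : R) : 0 < e -> exists N, forall m n x, (N <= m)%N -> (N <= n)%N ->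
    sqmod (u m x - u n x) < e.
  move=> /uC2[N uN]; exists N => m n x Nm Nn; rewrite -lte_fin.
  apply: le_lt_trans (uN m n Nm Nn).
  exact: (@nnsum_ge _ _ (fun x => sqmod ((u m - u n) x))).
have /choice[lr lrP] x : exists l : R, (fun n => complex.Re (u n x)) @ \oo --> l.
  apply: real_cauchy => e e0; have [|N uN] := uC3 (e ^+ 2); first exact: exprn_gt0.
  exists N => m n Nm Nn; have {uN} := uN m n x Nm Nn.
  rewrite /sqmod; case: (u m x) (u n x) => a b [c d] /= abcd.
  rewrite -(@ltr_pXn2r _ 2) ?nnegrE ?normr_ge0 ?(ltW e0)//.
  rewrite -normrX ger0_norm ?sqr_ge0//; apply: le_lt_trans abcd.
  by rewrite lerDl sqr_ge0.
have /choice[li liP] x : exists l : R, (fun n => complex.Im (u n x)) @ \oo --> l.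
  apply: real_cauchy => e e0; have [|N uN] := uC3 (e ^+ 2); first exact: exprn_gt0.
  exists N => m n Nm Nn; have {uN} := uN m n x Nm Nn.
  rewrite /sqmod; case: (u m x) (u n x) => a b [c d] /= abcd.
  rewrite -(@ltr_pXn2r _ 2) ?nnegrE ?normr_ge0 ?(ltW e0)//.
  rewrite -normrX ger0_norm ?sqr_ge0//; apply: le_lt_trans abcd.
  by rewrite lerDr sqr_ge0.
pose l x := Complex (lr x) (li x).
have lP (e : R) : 0 < e -> exists N, forall m, (N <= m)%N ->
    (nnsum (fun x => sqmod (u m x - l x))%R <= e%:E)%E.
  move=> /uC2[N uN]; exists N => m Nm; apply: ge_ereal_sup => _ [A [fA _] <-].
  rewrite fsumEFin// lee_fin.
  have cv : (fun n => \sum_(x \in A) sqmod (u m x - u n x)) @ \oo -->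
      \sum_(x \in A) sqmod (u m x - l x).
    under eq_fun do rewrite fsbig_finite//.
    rewrite fsbig_finite//; apply: (cvg_big (op := +%R)) => // [|x _]; first by move=> ?; exact: add_continuous.
    rewrite /sqmod (_ : complex.Re (_ - _) = complex.Re (u m x) - lr x); last first.
      by case: (u m x).
    rewrite (_ : complex.Im (_ - _) = complex.Im (u m x) - li x); last first.
      by case: (u m x).
    under eq_fun do rewrite !raddfB/= !expr2.
    rewrite !expr2; apply: cvgD; apply: cvgM; apply: cvgB;
      by [exact: cvg_cst|exact: lrP|exact: liP].
  apply: (ler_cvg_to cv (cvg_cst e)); exists N => // n /= Nn.
  rewrite -lee_fin -fsumEFin//; apply: le_trans (ltW (uN m n Nm Nn)).
  by apply: ereal_sup_ubound; exists A.
have l2 : l \in square_summable.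
  have [N /(_ N (leqnn N)) uN] := lP 1 ltr01.
  have dl : (fun x => u N x - l x) \in square_summable.
    by apply/asboolP; apply: le_lt_trans uN _; rewrite ltry.
  rewrite (_ : l = (u N : X -> R[i]) - (fun x => u N x - l x)); last first.
    by apply/funext => x; rewrite !fctE subKr.
  by apply: rpredB dl; exact: ell2P.
exists (Ell2 l2); apply/cvgrPdist_le => e e0.
have [|N uN] := lP (e ^+ 2); first exact: exprn_gt0.
exists N => // n /= Nn; rewrite sub0r normrN ger0_norm ?sqrtr_ge0//.
rewrite ell2_normE -[leRHS](ger0_norm (ltW e0)) -sqrtr_sqr.
by apply: ler_wsqrtr; rewrite -lee_fin fK; exact: uN.
Qed.

Definition ell2_hilbert : hilbert R := Hilbert ell2_complete.

End Ell2.

Section Representations.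
Variables (R : realType) (G : groupType).

Record unitary_rep := UnitaryRep {
  rep_space : hilbert R;
  rep_op : G -> rep_space -> rep_space;
  rep_linear : forall g, linear (rep_op g);
  rep_unitary : forall g v w,
    hip rep_space (rep_op g v) (rep_op g w) = hip rep_space v w;
  rep_op1 : forall v, rep_op 1%g v = v;
  rep_opM : forall g h v, rep_op (g * h)%g v = rep_op g (rep_op h v) }.

(* finitely supported functions represent the elements of the group algebra *)
Definition rep_alg (pi : unitary_rep) (a : {fsfun G -> R[i] with 0})
    (v : rep_space pi) : rep_space pi :=
  \sum_(g <- finsupp a) a g *: rep_op g v.

Definition rep_opnorm (pi : unitary_rep) (a : {fsfun G -> R[i] with 0}) :
    \bar R :=
  ereal_sup [set (hnorm (rep_alg a v))%:E
            | v in [set v : rep_space pi | hnorm v <= 1]].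

Definition weakly_contained (pi rho : unitary_rep) : Prop :=
  forall a, (rep_opnorm pi a <= rep_opnorm rho a)%E.

Definition weakly_equivalent (pi rho : unitary_rep) : Prop :=
  weakly_contained pi rho /\ weakly_contained rho pi.

End Representations.

Section QuasiRegular.
Variables (R : realType) (G : groupType) (H : set G).

Definition cosets : set (set G) := range (fun g : G => lcoset g H).

Lemma lcosetM g h (A : set G) : lcoset (g * h)%g A = lcoset g (lcoset h A).
Proof.
by rewrite /lcoset image_comp; apply: eq_imagel => x _ /=; rewrite mulgA.
Qed.

Lemma lcoset1 (A : set G) : lcoset 1%g A = A.
Proof.
rewrite /lcoset (_ : (fun x => 1 * x)%g = id) ?image_id//.
by apply/funext => x; rewrite mul1g.
Qed.

Lemma coset_act_subproof g (C : cosets) : lcoset g (\val C) \in cosets.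
Proof.
have [h _ hC] := set_mem (valP C).
by apply/mem_set; exists (g * h)%g; rewrite // lcosetM hC.
Qed.

Definition coset_act g (C : cosets) : cosets := SigSub (coset_act_subproof g C).

Lemma coset_actM g h C : coset_act (g * h)%g C = coset_act g (coset_act h C).
Proof. by apply: val_inj; exact: lcosetM. Qed.

Lemma coset_act1 C : coset_act 1%g C = C.
Proof. by apply: val_inj; exact: lcoset1. Qed.

Lemma coset_act_bij g : set_bij [set: cosets] [set: cosets] (coset_act g).
Proof.
have gK h : cancel (coset_act h) (coset_act h^-1).
  by move=> C; rewrite -coset_actM mulVg coset_act1.
split=> // [C D _ _ /(can_inj (gK g))//|C _].
by exists (coset_act g^-1 C) => //; have := gK g^-1%g C; rewrite invgK.
Qed.

Lemma nnsum_coset_act g (a : cosets -> R) :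
  nnsum (fun C => a (coset_act g C)) = nnsum a.
Proof. by rewrite /nnsum [RHS](reindex_esum _ _ _ _ (coset_act_bij g)). Qed.

Let qr_subproof g (f : ell2 R cosets) :
  (fun C => f (coset_act g^-1 C)) \in @square_summable R cosets.
Proof.
apply/asboolP; rewrite (nnsum_coset_act g^-1 (fun C => sqmod (f C))).
exact: ell2_lt.
Qed.

Definition qr_op g (f : ell2 R cosets) : ell2 R cosets := Ell2 (qr_subproof g f).

Let qr_linear g : linear (qr_op g). Proof. by move=> c f1 f2; exact: val_inj. Qed.

Let qr_unitary g (f1 f2 : ell2_hilbert R cosets) :
  hip (ell2_hilbert R cosets) (qr_op g f1) (qr_op g f2) =
  hip (ell2_hilbert R cosets) f1 f2.
Proof.
have rsumJ (h : cosets -> R) : rsum (fun C => h (coset_act g^-1 C)) = rsum h.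
  rewrite /rsum; congr (fine _ - fine _).
    exact: (nnsum_coset_act g^-1 (fun C => Num.max (h C) 0)).
  exact: (nnsum_coset_act g^-1 (fun C => Num.max (- h C) 0)).
by congr Complex; [exact: (rsumJ (fun C => complex.Re (f1 C * (f2 C)^*%C)))|
                   exact: (rsumJ (fun C => complex.Im (f1 C * (f2 C)^*%C)))].
Qed.

Let qr_op1 f : qr_op 1%g f = f.
Proof.
by apply/val_inj/funext => C; rewrite /= invg1 coset_act1.
Qed.

Let qr_opM g h f : qr_op (g * h)%g f = qr_op g (qr_op h f).
Proof.
by apply/val_inj/funext => C; rewrite /= invgM coset_actM.
Qed.

Definition quasi_regular : unitary_rep R G :=
  @UnitaryRep R G (ell2_hilbert R cosets) qr_op
    qr_linear qr_unitary qr_op1 qr_opM.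

End QuasiRegular.

(* Main.v *)
Require Import Defs.
From mathcomp Require Import all_boot all_order all_algebra finmap.
From mathcomp Require Import all_classical all_reals all_analysis.
From mathcomp Require Import complex ring lra.

(** Idea. An element of [G] outside [L] is approximated by elements of [L] leaving
    every finite set: existential closedness realizes finite pieces of the
    [L * L]-space [G \ L] inside [L], away from any given finite subset, and an
    ultralimit yields points of the Stone-Cech remainder of [L]. Bi-exactness then
    gives asymptotically [L * L]-equivariant maps from [G \ L] to [Prob (L * L)];
    their first marginals are asymptotically invariant on the right, so that an
    almost invariant measure on [(G / L) \ {L}] would produce an invariant mean
    on [L]. Hence, [L] being non-amenable, the action of [L] on [(G / L) \ {L}] has
    a spectral gap, in particular no finite orbit, which is part (1).

    For part (2), let [h] be an averaging operator over a finite subset of [L]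
    witnessing the gap. In [l2(G / L)], the powers of [h] converge in norm to the
    projection [p] on the base point, with [t p = p] for [t] in [L] and [p g p = 0]
    for [g] outside [L]. These norm relations pass to [l2(G / L')] by weak
    equivalence: there is a nonzero [L]-invariant vector, so [L] has a finite orbit
    in [G / L'], and [<g u, u> = 0] for invariant [u >= 0] and [g] outside [L] forces
    the stabilizer of a point of that orbit, a conjugate of [L'], to be contained in
    [L] with finite index. As [L'] is self-commensurating, they are equal. *)

Set Implicit Arguments.
Unset Strict Implicit.
Unset Printing Implicit Defensive.

Import Order.TTheory GRing.Theory Num.Theory.
Import numFieldNormedType.Exports.

Local Open Scope classical_set_scope.
Local Open Scope ring_scope.

(** * Ultralimits along a free ultrafilter, and amenability *)

Lemma countable_enum (T : choiceType) (x0 : T) :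
  countable [set: T] -> exists e : nat -> T, forall x, exists n, e n = x.
Proof.
move=> /countable_injP[f finj].
exists (fun n => xget x0 [set x | f x = n]) => x; exists (f x).
by apply: finj; rewrite ?inE//; exact: (@xgetPex _ _ [set y | f y = f x] (ex_intro _ x erefl)).
Qed.

Lemma ultra_infty : exists U : set_system nat, UltraFilter U /\ \oo `<=` U.
Proof. exact: ultraFilterLemma. Qed.

Lemma ultra_bounded_cvg (R : realType) (U : set_system nat) (u : nat -> R) (a b : R) :
  UltraFilter U -> (forall n, a <= u n <= b) -> exists l : R, u @ U --> l.
Proof.
move=> uU ub; have := @segment_compact R a b; rewrite compact_ultra.
move=> /(_ (u @ U) (ultra_fmap u uU))[|l [_ ul]]; last by exists l.
apply: (@filterS _ U _ setT); last exact: filterT.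
by move=> n _; rewrite /= in_itv/=.
Qed.

(* A fixed set [S] and a one-sided inequality suffice: applied to [g] and [g^-1],
   the inequality gives the invariance of the limit. *)
Lemma amenable_of_almost_invariant (R : realType) (L : groupType) :
  countable [set: L] ->
  (forall (S : seq L) (e : R), 0 < e -> exists m : set L -> R,
     [/\ (forall A, 0 <= m A), m setT = 1,
         (forall A B, A `&` B = set0 -> m (A `|` B) = m A + m B) &
         (forall s A, s \in S -> m (lcoset s A) <= m A + e)]) ->
  amenable R L.
Proof.
move=> /(countable_enum 1%g)[en enP] H.
(* Stage [n] handles the first [n + 1] elements of [L] up to [1 / (n + 1)], so each element is
   handled at all but finitely many stages. *)
have /choice[m mP] n := H [seq en i | i <- seq.iota 0 n.+1] n.+1%:R^-1
  (ltac:(by rewrite invr_gt0 ltr0n)).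
have [U [uU oU]] := ultra_infty.
have m01 n A : 0 <= m n A <= 1.
  have [m0 m1 mD _] := mP n; rewrite m0 -m1 -(setUv A) mD ?setICr//.
  by rewrite lerDl m0.
have /choice[l lP] A := ultra_bounded_cvg uU (m01 ^~ A).
have le_l g A : l (lcoset g A) <= l A.
  have c1 : (fun n => m n A + n.+1%:R^-1) @ U --> l A + 0.
    by apply: cvgD (lP A) _; apply: cvg_trans (cvg_app _ oU) _; exact: cvg_harmonic.
  rewrite -[l A]addr0; apply: (ler_cvg_to (lP (lcoset g A)) c1).
  have [k <-] := enP g; apply: oU; exists k => // n /= kn.
  have [_ _ _ ->//] := mP n; apply/map_f.
  by rewrite mem_iota/= add0n ltnS.
exists l; split=> [A||A B AB|g A].
- apply: (ler_cvg_to (cvg_cst 0) (lP A)); apply: oU; exists 0%N => // n _.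
  by have /andP[] := m01 n A.
- apply: (cvg_unique _ (lP setT)) => //; rewrite (_ : m^~ setT = fun=> 1); first exact: cvg_cst.
  by apply/funext => n; have [] := mP n.
- apply: (cvg_unique _ (lP (A `|` B))) => //.
  rewrite (_ : m^~ (A `|` B) = fun n => m n A + m n B); last first.
    by apply/funext => n; have [_ _ ->] := mP n.
  exact: cvgD (lP A) (lP B).
- apply/eqP; rewrite eq_le le_l/= -{1}(lcoset1 A) -(mulVg g) lcosetM.
  exact: le_l.
Qed.

(** * Existential formulas and points of the Stone-Cech remainder *)

Definition big_and (K : Type) (n : nat) (k0 : K) (fs : seq (qf_formula K n)) :=
  foldr (@FAnd K n) (FEq (WConst n k0) (WConst n k0)) fs.

Lemma big_andP (K : Type) (G : groupType) (c : K -> G) n v k0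
    (I : eqType) (F : I -> qf_formula K n) (s : seq I) :
  qf_holds c v (big_and k0 [seq F i | i <- s]) <->
  forall i, i \in s -> qf_holds c v (F i).
Proof.
elim: s => [|i s IH] //=; split.
  by move=> [hi /IH hs] j; rewrite inE => /predU1P[->|/hs].
move=> h; split; first by apply: h; rewrite inE eqxx.
by apply/IH => j js; apply: h; rewrite inE js orbT.
Qed.

Section Embedding.
Variables (L G : groupType) (iota : {multiplicative L -> G}).

Definition biact (q : L * L) (g : G) : G := (iota q.1 * g * (iota q.2)^-1)%g.

(** The partial action table of [S] on [E], together with the fact that no point of [E] is a
    constant from [K], is a quantifier-free formula with variables indexed by [E]. In [G] it is
    solved by [E] itself; a solution in [L] is the required [w]. *)
Lemma ex_embedding_partial (E : seq G) (S : seq (L * L)) (K : seq L) :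
  existential_embedding iota -> (forall e, e \in E -> ~ range iota e) ->
  exists w : G -> L,
    (forall e, e \in E -> w e \notin K) /\
    (forall q e, q \in S -> e \in E -> biact q e \in E ->
       w (biact q e) = bitranslate q (w e)).
Proof.
(* The successor keeps ['I_n] inhabited when [E] is empty, as [inord] requires. *)
move=> [iinj iex] nE; pose n := (size E).+1.
pose var (e : G) : 'I_n := inord (index e E).
pose Feq (p : (L * L) * G) : qf_formula L n :=
  FEq (WVar L (var (biact p.1 p.2)))
      (WMul (WMul (WConst n p.1.1) (WVar L (var p.2))) (WInv (WConst n p.1.2))).
pose Fne (p : G * L) : qf_formula L n := FNot (FEq (WVar L (var p.1)) (WConst n p.2)).
(* Only translates that stay in [E] have a variable of their own. *)
pose P := [seq p <- [seq (q, e) | q <- S, e <- E] | biact p.1 p.2 \in E].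
pose psi := FAnd (big_and 1%g [seq Feq p | p <- P])
                 (big_and 1%g [seq Fne p | p <- [seq (e, k) | e <- E, k <- K]]).
have varE e : e \in E -> nth 1%g E (var e) = e.
  by move=> eE; rewrite inordK ?nth_index// ltnW// ltnS index_mem.
have PP q e : q \in S -> e \in E -> biact q e \in E -> (q, e) \in P.
  by move=> qS eE qeE; rewrite mem_filter qeE/= allpairs_f.
have [w []] : models_ex (@idfun L) psi.
  apply/iex; exists (fun i => nth 1%g E i); split; apply/big_andP.
    move=> [q e]; rewrite mem_filter => /andP[/= qeE /allpairsP[[q' e'] /= [_ eE [_ ee]]]].
    by subst e'; rewrite !varE.
  move=> [e k] /allpairsP[[e' k'] /= [eE _ [-> ->]]]; rewrite varE//= => ek.
  by apply: (nE _ eE); exists k'.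
move=> /big_andP wS /big_andP wK; exists (fun e => w (var e)); split.
  move=> e eE; apply/negP => /(allpairs_f (fun e k => (e, k)) eE) /wK/=; exact.
by move=> q e qS eE qeE; have := wS _ (PP _ _ qS eE qeE).
Qed.

(* The point attached to [e] is an ultralimit of partial maps avoiding larger and
   larger finite subsets of [L]. *)
Lemma ex_embedding_remainder (E : seq G) (S : seq (L * L)) :
  countable [set: L] ->
  existential_embedding iota -> (forall e, e \in E -> ~ range iota e) ->
  exists p : G -> stoneCech L,
    (forall e, e \in E -> sc_remainder (p e)) /\
    (forall q e, q \in S -> e \in E -> biact q e \in E ->
       sc_map (bitranslate q) (p e) = p (biact q e)).
Proof.
move=> /(countable_enum 1%g)[en enP] iex nE.
have /choice[w wP] n := ex_embedding_partial S [seq en i | i <- seq.iota 0 n.+1] iex nE.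
have [U [uU oU]] := ultra_infty.
exists (fun e => StoneCech (ultra_fmap (w^~ e) uU)); split.
  (* Were the ultralimit principal at [x = en k], some [n >= k] would have [w n e = x], although
     [w n] avoids [en 0], ..., [en n]. *)
  move=> e eE [x _ px]; have : sc_filter (sc_pure x) [set x].
    exact/principal_filterP.
  rewrite px/= => Ux; have [k ek] := enP x.
  have : U [set n | (k <= n)%N] by apply: oU; exists k.
  move=> /(filterI Ux)/filter_ex[n [/= wx kn]]; have [/(_ e eE)/negP+ _] := wP n.
  by apply; rewrite wx -ek; apply: map_f; rewrite mem_iota/= add0n ltnS.
move=> q e qS eE qeE; apply: stoneCechP => /=; rewrite predeqE => A.
suff -> : (fun n => w n (biact q e)) = (fun n => bitranslate q (w n e)) by [].
by apply/funext => n; have [_ ->] := wP n.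
Qed.

End Embedding.

(** * Sums of nonnegative families *)

Section NNSum.
Variable R : realType.

Lemma nnsum_bij (X Y : choiceType) (f : X -> Y) (g : Y -> X) (a : Y -> R) :
  cancel f g -> cancel g f -> nnsum (fun x => a (f x)) = nnsum a.
Proof.
move=> fK gK; have fb : set_bij [set: X] [set: Y] f.
  by split=> // [x y _ _ /(can_inj fK)//|y _]; exists (g y); rewrite ?gK.
by rewrite /nnsum [RHS](reindex_esum _ _ _ _ fb).
Qed.

Lemma nnsum_finite (X : choiceType) (F : set X) (a : X -> R) :
  finite_set F -> (forall x, 0 <= a x) ->
  nnsum (fun x => a x * \1_F x) = (\sum_(x \in F) a x)%:E.
Proof.
move=> fF a0; rewrite -fsumEFin// -esum_fset//; last first.
  by move=> x _; rewrite lee_fin.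
rewrite esum_mkcond; apply: eq_esum => x _.
by rewrite indicE; case: ifPn => _; rewrite ?mulr1 ?mulr0.
Qed.

Lemma nnsum_indic_finite (X : choiceType) (F : set X) :
  finite_set F -> (nnsum (\1_F : X -> R) < +oo)%E.
Proof.
move=> fF; have := nnsum_finite fF (fun _ : X => @ler01 R).
by under eq_fun do rewrite mul1r; move=> ->; rewrite ltry.
Qed.

(** [F] is a finite set whose partial sum comes within [e] of the supremum defining the total. *)
Lemma nnsum_tail (X : choiceType) (a : X -> R) (e : R) :
  (forall x, 0 <= a x) -> (nnsum a < +oo)%E -> 0 < e ->
  exists2 F : set X, finite_set F & (nnsum (fun x => (a x * \1_(~` F) x)%R) <= e%:E)%E.
Proof.
move=> a0 afin e0; have fa := nnsum_fin a0 afin.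
have [y [F [fF _] <-] Fe] : exists2 y, [set \sum_(x \in A) (a x)%:E | A in fsets setT] y &
    (nnsum a - e%:E < y)%E.
  exact: ub_ereal_sup_adherent.
exists F => //; have split_a : nnsum a =
    (nnsum (fun x => (a x * \1_F x)%R) + nnsum (fun x => (a x * \1_(~` F) x)%R))%E.
  rewrite -nnsumD; first last.
  - by move=> x; rewrite mulr_ge0// indicE.
  - by move=> x; rewrite mulr_ge0// indicE.
  congr nnsum; apply/funext => x /=; rewrite !indicE in_setC.
  by case: (x \in F); rewrite /= ?mulr1 ?mulr0 ?addr0 ?add0r.
have b0 : forall x, 0 <= a x * \1_(~` F) x by move=> x; rewrite mulr_ge0// indicE.
have bfin : (nnsum (fun x => (a x * \1_(~` F) x)%R) < +oo)%E.
  by apply: lt_nnsum afin => x; rewrite ler_piMr// indicE; case: (_ \in _).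
move: Fe; rewrite fsumEFin// split_a nnsum_finite//.
rewrite -(fineK (nnsum_fin b0 bfin)) -!EFinD lte_fin lee_fin; lra.
Qed.

Lemma nnsum_le_addr (X : choiceType) (a b c : X -> R) :
  (forall x, 0 <= c x) -> (forall x, 0 <= b x) ->
  (forall x, a x <= b x + c x) ->
  (nnsum a <= nnsum b + nnsum c)%E.
Proof. by move=> c0 b0 abc; rewrite -nnsumD//; exact: le_nnsum. Qed.

End NNSum.

(** * First marginals of probability measures on [L * L] *)

Section Marginal.
Variables (R : realType) (L : groupType).
Implicit Types (m : L * L -> R) (A B : set L).

Lemma nnsum_translate (s : (L * L)%type) (a : (L * L)%type -> R) :
  nnsum (translate_measure s a) = nnsum a.
Proof.
by apply: (nnsum_bij (g := fun t => (s * t)%g) a) => t; rewrite ?mulKg ?mulVKg.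
Qed.

Lemma prob_translate (s : (L * L)%type) (a : (L * L)%type -> R) :
  prob_measure a -> prob_measure (translate_measure s a).
Proof.
move=> [a0 a1]; split; first by move=> t; exact: a0.
exact: etrans (nnsum_translate s a) a1.
Qed.

Lemma nnsum_prob_sub (a b : (L * L)%type -> R) : prob_measure a -> prob_measure b ->
  (nnsum (fun t => `|a t - b t|%R) <= 2%:E)%E.
Proof.
move=> [a0 a1] [b0 b1]; have -> : (2%:E = nnsum a + nnsum b :> \bar R)%E.
  by rewrite [nnsum a]a1 [nnsum b]b1 -EFinD.
rewrite -nnsumD//; apply: le_nnsum => t /=.
by rewrite (le_trans (ler_normB _ _))// !ger0_norm.
Qed.

Lemma l1norm_nnsum (a b : (L * L)%type -> R) : prob_measure a -> prob_measure b ->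
  (l1norm (a \- b))%:E = nnsum (fun t => `|a t - b t|).
Proof.
move=> pa pb; rewrite fineK//; apply: nnsum_fin => //.
exact: le_lt_trans (nnsum_prob_sub pa pb) (ltry _).
Qed.

Definition marginal (m : (L * L)%type -> R) A : R :=
  fine (nnsum (fun t => m t * \1_A t.1)).

Lemma marginalE m A : prob_measure m ->
  (marginal m A)%:E = nnsum (fun t => m t * \1_A t.1).
Proof.
move=> [m0 m1]; rewrite fineK//; apply: nnsum_fin => [t|].
  by rewrite mulr_ge0// indicE.
apply: (@le_lt_trans _ _ (nnsum m)); last by rewrite [nnsum m]m1 ltry.
by apply: le_nnsum => t; rewrite ler_piMr// indicE; case: (_ \in _).
Qed.

Lemma marginal_ge0 m A : prob_measure m -> 0 <= marginal m A.
Proof.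
move=> pm; rewrite -lee_fin marginalE//; apply: nnsum_ge0 => t.
by rewrite mulr_ge0 ?indicE//; exact: (proj1 pm).
Qed.

Lemma marginalT m : prob_measure m -> marginal m setT = 1.
Proof.
move=> pm; apply: EFin_inj; rewrite marginalE// -[RHS](proj2 pm).
by congr nnsum; apply/funext => t; rewrite indicE in_setT mulr1.
Qed.

Lemma marginalU m A B : prob_measure m -> A `&` B = set0 ->
  marginal m (A `|` B) = marginal m A + marginal m B.
Proof.
move=> pm AB; apply: EFin_inj; rewrite EFinD !marginalE// -nnsumD; first last.
- by move=> t; rewrite mulr_ge0 ?indicE//; exact: (proj1 pm).
- by move=> t; rewrite mulr_ge0 ?indicE//; exact: (proj1 pm).
congr nnsum; apply/funext => t /=; rewrite -mulrDr; congr (_ * _).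
rewrite !indicE in_setU; case: (boolP (t.1 \in A)) => tA /=; last by rewrite add0r.
rewrite (_ : t.1 \in B = false) ?addr0//; apply/negbTE/negP => tB.
by have : set0 t.1 by rewrite -AB; split; exact: set_mem.
Qed.

Lemma marginal_le1 m A : prob_measure m -> marginal m A <= 1.
Proof.
move=> pm; rewrite -(marginalT pm) -(setUv A) marginalU ?setICr//.
by rewrite lerDl marginal_ge0.
Qed.

(** Translation by [(s^-1, t)] turns the cylinder over [s A] into the cylinder over [A], whatever
    [t] is. This freedom in [t] later absorbs the choice of coset representatives. *)
Lemma marginal_lcoset (m m' : (L * L)%type -> R) s t A :
  prob_measure m -> prob_measure m' ->
  marginal m (lcoset s A) <=
  marginal m' A + l1norm (translate_measure (s^-1%g, t) m \- m').
Proof.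
move=> pm pm'; rewrite -lee_fin EFinD.
have -> := l1norm_nnsum (prob_translate (s^-1%g, t) pm) pm'.
rewrite !marginalE// -nnsumD//; last first.
  by move=> x; rewrite mulr_ge0 ?indicE//; exact: (proj1 pm').
rewrite -(nnsum_translate (s^-1%g, t)); apply: le_nnsum => x /=.
rewrite {1}/translate_measure.
have -> : \1_(lcoset s A) ((s^-1%g, t)^-1 * x)%g.1 = \1_A x.1 :> R.
  rewrite !indicE; congr (_%:R); congr nat_of_bool; apply/idP/idP => /set_mem.
    move=> [y Ay]; rewrite /= invgK => /mulgI <-; exact: mem_set.
  by move=> Ax; apply: mem_set; exists x.1 => //=; rewrite invgK.
rewrite /translate_measure; set u := m _.
have m'0 : 0 <= m' x by exact: (proj1 pm').
by rewrite !indicE; case: (_ \in _); rewrite ?mulr1 ?mulr0 ?add0r// -lerBlDl ler_norm.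
Qed.

End Marginal.

(** If the image were principal at [y], pushing it forward by [g] would make [x] principal at
    [g y]. *)
Lemma sc_map_remainder (T U : Type) (f : T -> U) (g : U -> T) (x : stoneCech T) :
  cancel f g -> sc_remainder x -> sc_remainder (sc_map f x).
Proof.
move=> fK rx [y _ xy]; apply: rx; exists (g y) => //.
rewrite -sc_map_pure xy; apply: stoneCechP => /=; rewrite predeqE => A.
by rewrite /nbhs/= (_ : _ @^-1` (_ @^-1` A) = A)//; apply/funext => t /=; rewrite fK.
Qed.

Lemma multiplicative1 (L G : groupType) (f : {multiplicative L -> G}) :
  f 1%g = 1%g.
Proof. by apply: (@mulgI _ (f 1%g)); rewrite -gmulfM !mulg1. Qed.

Lemma multiplicativeV (L G : groupType) (f : {multiplicative L -> G}) x :
  f (x^-1)%g = (f x)^-1%g.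
Proof. by apply: (@mulgI _ (f x)); rewrite -gmulfM !mulgV multiplicative1. Qed.

(** * Coset spaces and representatives *)

Section Cosets.
Variables (G : groupType) (H : set G).
Hypothesis Hsub : subgroup H.

Lemma mkcoset_subproof g : lcoset g H \in cosets H.
Proof. by apply/mem_set; exists g. Qed.

Definition mkcoset g : cosets H := SigSub (mkcoset_subproof g).

Lemma coset_act_mk g h : coset_act g (mkcoset h) = mkcoset (g * h)%g.
Proof. by apply: val_inj; rewrite /= lcosetM. Qed.

Definition coset_rep (x : cosets H) : G := sval (cid2 (set_mem (valP x))).

Lemma coset_repK x : mkcoset (coset_rep x) = x.
Proof. by apply: val_inj; rewrite /= /coset_rep; case: cid2. Qed.

Lemma subgroup_inv g : H g -> H (g^-1)%g.
Proof.
have /subgroupP[H1 HB] := Hsub.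
by move=> Hg; rewrite -[(g^-1)%g]mul1g; exact: HB.
Qed.

Lemma subgroup_mul g h : H g -> H h -> H (g * h)%g.
Proof.
have /subgroupP[H1 HB] := Hsub.
by move=> Hg Hh; rewrite -[h]invgK; apply: HB => //; exact: subgroup_inv.
Qed.

Lemma mkcosetP g h : mkcoset g = mkcoset h <-> H (g^-1 * h)%g.
Proof.
have /subgroupP[H1 HB] := Hsub; split=> [/(congr1 val)/= gh|Hgh].
  have : lcoset g H h by rewrite gh; exists 1%g; rewrite ?mulg1.
  by move=> [k Hk <-]; rewrite mulKg.
apply: val_inj => /=; rewrite predeqE => x; split=> -[k Hk <-].
  exists ((g^-1 * h)^-1 * k)%g; last by rewrite invgM invgK !mulgA mulgV mul1g.
  by apply: subgroup_mul => //; exact: subgroup_inv.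
exists (g^-1 * h * k)%g; first exact: subgroup_mul.
by rewrite !mulgA mulgV mul1g.
Qed.

End Cosets.

(** * From bi-exactness to an l1 spectral gap off the base coset *)

Section SpectralGap.
Variables (R : realType) (L G : groupType) (iota : {multiplicative L -> G}).
Hypotheses (Lcount : countable [set: L]) (Lexact : bi_exact R L)
  (Lex : existential_embedding iota).

(** The measure at [e] is [mu N] at the remainder point attached to [e]. These points are
    equivariant for [S] inside [E], and as [S] is finite one [N] serves all of its elements. *)
Lemma approx_equivariant (E : seq G) (S : seq (L * L)) (eps : R) : 0 < eps ->
  (forall e, e \in E -> ~ range iota e) ->
  exists m : G -> (L * L)%type -> R,
    (forall e, e \in E -> prob_measure (m e)) /\
    (forall q e, q \in S -> e \in E -> biact iota q e \in E ->
       l1norm (translate_measure q (m e) \- m (biact iota q e)) <= eps).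
Proof.
move=> eps0 nE; have [p [pE pS]] := ex_embedding_remainder S Lcount Lex nE.
have [mu [muP _ mu0]] := Lexact.
suff : \forall N \near \oo, forall q, q \in S -> forall x, @sc_remainder L x ->
    l1norm (translate_measure q (mu N x) \- mu N (sc_map (bitranslate q) x)) <= eps.
  move=> [N _ /(_ N (leqnn N)) NP].
  exists (fun e => mu N (p e)); split; first by move=> e eE; apply: muP; exact: pE.
  by move=> q e qS eE qeE; rewrite -(pS q e)//; apply: NP => //; exact: pE.
elim: S {pS} => [|q S IH]; first by exists 0%N.
have /cvgrPdist_le/(_ eps eps0) := mu0 q.
move: IH; apply: filterS2 => n IH; rewrite sub0r normrN => supn q' q'S x rx.
move: q'S; rewrite inE => /predU1P[->|q'S]; last exact: IH.
apply: le_trans (le_trans (ler_norm _) supn); apply: ub_le_sup; last by exists x.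
have qK : cancel (@bitranslate L q) (bitranslate (q^-1)%g).
  by move=> t; rewrite /bitranslate/= invgK !mulgA mulVg mul1g -mulgA mulVg mulg1.
(* [sup] bounds the elements of a set only if the set is bounded; two probability measures are at l1
   distance at most 2. *)
exists 2 => _ [y ry <-]; have p1 := prob_translate q (muP n y ry).
have p2 := muP n _ (sc_map_remainder qK ry).
by rewrite -lee_fin l1norm_nnsum// nnsum_prob_sub.
Qed.

Local Notation H := (range iota).

Lemma subgroup_range : subgroup H.
Proof.
apply/subgroupP; split; first by exists 1%g; rewrite ?multiplicative1.
by move=> _ _ [x _ <-] [y _ <-]; exists (x / y)%g => //; rewrite gmulfM multiplicativeV.
Qed.

Local Notation act s := (@coset_act G H (iota s)).

(* Otherwise an almost invariant [nu] yields the almost invariant mean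
   [A |-> sum_x nu x * m_x (A * L)] on [L], where [m_x] is the approximately equivariant
   measure at a representative of [x]: its first marginal does not see the right
   translations by which representatives differ. The point mass at [1] fills in
   outside a finite set carrying most of [nu]. *)
Lemma invariant_mean_transfer :
  ~ amenable R L ->
  exists (S : seq L) (eps : R), 0 < eps /\ forall nu : cosets H -> R,
    (forall x, 0 <= nu x) -> nu (mkcoset H 1%g) = 0 -> (nnsum nu < +oo)%E ->
    (eps%:E * nnsum nu <=
      \sum_(s <- S) nnsum (fun x => `|nu (act s x) - nu x|%R))%E.
Proof.
move=> nam; apply: contrapT => nS; apply: nam.
apply: amenable_of_almost_invariant => // S e e0.
(* Three errors of this size will add up: the failure of equivariance of the [m_x], the mass of [nu]
   outside [F], and the failure of invariance of [nu]. *)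
have e40 : 0 < e / 4 by rewrite divr_gt0.
(* A measure violating the inequality for [S] and [e / 4] has positive mass and is normalized. *)
have [nu [nu0 nub nu1 nuS]] : exists nu : cosets H -> R, [/\ forall x, 0 <= nu x,
    nu (mkcoset H 1%g) = 0, nnsum nu = 1%E &
    forall s, s \in S ->
      (nnsum (fun x => `|nu (act s x) - nu x|%R) <= (e / 4)%:E)%E].
  apply: contrapT => nnu; apply: nS; exists S, (e / 4); split=> // nu nu0 nub nufin.
  rewrite leNgt; apply/negP => lt_nu; apply: nnu.
  have [t t0 tE] : exists2 t : R, 0 < t & nnsum nu = t%:E.
    exists (fine (nnsum nu)); last by rewrite fineK// nnsum_fin.
    rewrite -lte_fin fineK ?nnsum_fin//.
    rewrite lt_neqAle nnsum_ge0// andbT eq_sym; apply/eqP => z.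
    move: lt_nu; rewrite z mule0 ltNge => /negP; apply.
    by apply: sume_ge0 => s _; apply: nnsum_ge0.
  have ti0 : 0 <= t^-1 by rewrite invr_ge0 ltW.
  exists (fun x => t^-1 * nu x); split.
  - by move=> x; rewrite mulr_ge0.
  - by rewrite nub mulr0.
  - by rewrite nnsumZ// tE -EFinM mulVf// gt_eqF.
  move=> s sS; have -> : (fun x => `|t^-1 * nu (act s x) - t^-1 * nu x|) =
      (fun x => t^-1 * `|nu (act s x) - nu x|).
    by apply/funext => x; rewrite -mulrBr normrM (ger0_norm ti0).
  rewrite nnsumZ// -(@lee_pmul2l _ t%:E)// ?lte_fin// muleA -EFinM.
  rewrite divff ?gt_eqF// mul1e muleC -tE (le_trans _ (ltW lt_nu))//.
  rewrite (big_rem s)//= leeDl// sume_ge0// => *; exact: nnsum_ge0.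
have nufin : (nnsum nu < +oo)%E by rewrite nu1 ltry.
have [F fF tailF] := nnsum_tail nu0 nufin e40.
(* The representative of the base coset lies in [H], where no measure is available; dropping it is
   harmless since [nu] vanishes there. *)
pose F' := [seq x <- enum_fset (fset_set F) | x != mkcoset H 1%g].
have F'P x : F x -> nu x != 0 -> x \in F'.
  move=> Fx nux; rewrite mem_filter; apply/andP; split.
    by apply: contraNneq nux => ->; rewrite nub.
  by have : x \in fset_set F by rewrite in_fset_set// mem_set.
pose E := [seq coset_rep x | x <- F' ++ [seq act s^-1%g x | s <- S, x <- F']].
have nE g : g \in E -> ~ H g.
  move=> /mapP[x xF ->] Hx; have xb : x = mkcoset H 1%g.
    rewrite -(coset_repK x); apply/mkcosetP; first exact: subgroup_range.
    by rewrite mulg1; apply: subgroup_inv => //; exact: subgroup_range.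
  move: xF; rewrite xb mem_cat mem_filter eqxx/= => /allpairsP[[s y] /= [_ + sy]].
  rewrite mem_filter => /andP[/eqP + _]; apply.
  have := congr1 (act s) sy; rewrite -coset_actM -gmulfM mulgV multiplicative1 coset_act1 => <-.
  rewrite coset_act_mk mulg1; apply/mkcosetP; first exact: subgroup_range.
  by rewrite mulg1; apply: subgroup_inv; [exact: subgroup_range|exists s].
(* Representatives are not equivariant: [t] is the right translation by which [s^-1] times that of
   [x] differs from that of [s^-1 x]. *)
have /choice[t tP] (p : L * cosets H) : exists t : L,
    biact iota (p.1^-1%g, t) (coset_rep p.2) = coset_rep (act p.1^-1%g p.2).
  case: p => s x /=.
  have : mkcoset H (coset_rep (act s^-1%g x)) = mkcoset H (iota s^-1 * coset_rep x)%g.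
    by rewrite -coset_act_mk !coset_repK.
  move=> /(mkcosetP subgroup_range)[u _ uE]; exists u.
  by rewrite /biact/= uE invgM invgK mulgA mulgV mul1g.
pose Q := [seq (s^-1%g, t (s, x)) | s <- S, x <- F'].
have [m [mE mQ]] := approx_equivariant Q e40 nE.
pose mx (x : cosets H) (A : set L) : R :=
  if coset_rep x \in E then marginal (m (coset_rep x)) A else \1_A 1%g.
have mx0 x A : 0 <= mx x A.
  by rewrite /mx; case: ifPn => xE; rewrite ?marginal_ge0 ?indicE//; exact: mE.
have mx1 x A : mx x A <= 1.
  rewrite /mx; case: ifPn => xE; rewrite ?marginal_le1 ?indicE//; first exact: mE.
  by case: (_ \in _).
have mxfin A : (nnsum (fun x => (nu x * mx x A)%R) < +oo)%E.
  by apply: lt_nnsum nufin => x; rewrite ler_piMr.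
have numx0 A x : 0 <= nu x * mx x A by rewrite mulr_ge0.
exists (fun A => fine (nnsum (fun x => (nu x * mx x A)%R))); split.
- by move=> A; rewrite fine_ge0// nnsum_ge0.
- apply: EFin_inj; rewrite fineK ?nnsum_fin// -nu1; congr nnsum; apply/funext => x.
  by rewrite /mx; case: ifPn => xE; rewrite ?marginalT ?indicE ?in_setT ?mulr1//; exact: mE.
- move=> A B AB; apply: EFin_inj; rewrite EFinD !fineK ?nnsum_fin// -nnsumD//.
  congr nnsum; apply/funext => x /=; rewrite -mulrDr; congr (_ * _).
  rewrite /mx; case: ifPn => xE; first by rewrite marginalU//; exact: mE.
  rewrite !indicE in_setU; case: (boolP (1%g \in A)) => tA /=; last by rewrite add0r.
  rewrite (_ : 1%g \in B = false) ?addr0//; apply/negbTE/negP => tB.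
  by have : set0 (1%g : L) by rewrite -AB; split; exact: set_mem.
move=> s A sS; rewrite -lee_fin EFinD !fineK ?nnsum_fin//.
(* First [s] passes from the set to the index of the measure, by equivariance on [F] and by a
   trivial bound off [F]; then [step2] passes it on to [nu] by reindexing the sum. *)
have step1 : (nnsum (fun x => (nu x * mx x (lcoset s A))%R) <=
    nnsum (fun x => nu x * mx (act s^-1%g x) A)%R +
    (nnsum (fun x => (e / 4) * nu x)%R + nnsum (fun x => nu x * \1_(~` F) x)%R))%E.
  rewrite -nnsumD; first last.
  - by move=> x; rewrite mulr_ge0// indicE.
  - by move=> x; rewrite mulr_ge0// ltW.
  apply: nnsum_le_addr => [x|x|x] /=.
  - by rewrite addr_ge0// mulr_ge0// ?indicE// ltW.
  - by rewrite mulr_ge0.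
  have [->|nux] := eqVneq (nu x) 0; first by rewrite !mul0r mulr0 !addr0.
  have nuxp : 0 < nu x by rewrite lt_neqAle eq_sym nux nu0.
  rewrite [e / 4 * _]mulrC -!mulrDr ler_pM2l// indicE in_setC.
  have [Fx|nFx] := pselect (F x); last first.
    rewrite memNset//=; have := mx1 x (lcoset s A).
    by have := mx0 (act s^-1%g x) A; lra.
  rewrite mem_set//= addr0; have xF' := F'P x Fx nux.
  have xE : coset_rep x \in E by apply: map_f; rewrite mem_cat xF'.
  have sxE : coset_rep (act s^-1%g x) \in E.
    by apply: map_f; rewrite mem_cat (allpairs_f (fun s x => act s^-1%g x))// orbT.
  have tx := tP (s, x); rewrite /= in tx.
  rewrite /mx xE sxE; apply: le_trans (marginal_lcoset s (t (s, x)) A (mE _ xE) (mE _ sxE)) _.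
  rewrite lerD2l -tx; apply: mQ => //; last by rewrite tx.
  exact: (allpairs_f (fun s x => (s^-1%g, t (s, x)))).
have step2 : (nnsum (fun x => (nu x * mx (act s^-1%g x) A)%R) <=
    nnsum (fun x => (nu x * mx x A)%R) + nnsum (fun x => `|nu (act s x) - nu x|%R))%E.
  rewrite -(nnsum_coset_act (iota s)); apply: nnsum_le_addr => // x.
  rewrite -coset_actM -gmulfM mulVg multiplicative1 coset_act1 -lerBlDl -mulrBl.
  by apply: le_trans (ler_norm _) _; rewrite normrM ler_piMr// ger0_norm.
apply: le_trans step1 _.
rewrite nnsumZ// ?nu1 ?mule1; last exact: ltW.
apply: le_trans (leeD (le_trans step2 (leeD2l _ (nuS s sS))) (leeD2l _ tailF)) _.
rewrite -addeA -!EFinD leeD2l// lee_fin; lra.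
Qed.

End SpectralGap.

(** * Squared norms in l2 *)

Section Ell2Norm.
Variables (R : realType) (X : choiceType).
Implicit Types v w : ell2 R X.

Definition sqnorm v : R := fine (nnsum (fun x => sqmod (v x))).

Lemma sqnormE v : (sqnorm v)%:E = nnsum (fun x => sqmod (v x)).
Proof. by rewrite fineK// nnsum_fin ?ell2_lt// => x; exact: sqmod_ge0. Qed.

Lemma sqnorm_ge0 v : 0 <= sqnorm v.
Proof. by rewrite -lee_fin sqnormE nnsum_ge0// => x; exact: sqmod_ge0. Qed.

Lemma ell2_hnormE v : hnorm (H := ell2_hilbert R X) v = Num.sqrt (sqnorm v).
Proof. exact: ell2_normE. Qed.

Lemma ell2_hnorm_sqr v : hnorm (H := ell2_hilbert R X) v ^+ 2 = sqnorm v.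
Proof. by rewrite ell2_hnormE sqr_sqrtr// sqnorm_ge0. Qed.

(** The left side is at most [|z - w| |z + w|]. Weighted AM-GM splits this product, and
    [|z + w|^2 <= 2 (|z|^2 + |w|^2)]. The free weight [h] lets the last term be absorbed in
    [spectral_gap]. *)
Lemma sqmod_sub_norm (z w : R[i]) (h : R) : 0 < h ->
  `|sqmod z - sqmod w| <= (2 * h)^-1 * sqmod (z - w) + h * (sqmod z + sqmod w).
Proof.
move=> h0; have hh : h * (2 * h)^-1 = 2^-1.
  by rewrite invfM mulrCA divff ?mulr1// gt_eqF.
have i0 : 0 < (2 * h)^-1 by rewrite invr_gt0 mulr_gt0.
move: hh i0; set k := (2 * h)^-1 => hk k0.
case: z w => a b [c d]; rewrite /sqmod/=.
rewrite ler_norml; apply/andP; split.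
- have := mulr_ge0 (ltW k0) (sqr_ge0 ((a - c) + h * (a + c))).
  have := mulr_ge0 (ltW k0) (sqr_ge0 ((b - d) + h * (b + d))).
  have := mulr_ge0 (ltW h0) (sqr_ge0 (a - c)); have := mulr_ge0 (ltW h0) (sqr_ge0 (b - d)).
  have -> : k * ((a - c) + h * (a + c)) ^+ 2 = k * (a - c) ^+ 2 +
    2 * (h * k) * (a - c) * (a + c) + h * (h * k) * (a + c) ^+ 2 by ring.
  have -> : k * ((b - d) + h * (b + d)) ^+ 2 = k * (b - d) ^+ 2 +
    2 * (h * k) * (b - d) * (b + d) + h * (h * k) * (b + d) ^+ 2 by ring.
  by rewrite hk; lra.
- have := mulr_ge0 (ltW k0) (sqr_ge0 ((a - c) - h * (a + c))).
  have := mulr_ge0 (ltW k0) (sqr_ge0 ((b - d) - h * (b + d))).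
  have := mulr_ge0 (ltW h0) (sqr_ge0 (a - c)); have := mulr_ge0 (ltW h0) (sqr_ge0 (b - d)).
  have -> : k * ((a - c) - h * (a + c)) ^+ 2 = k * (a - c) ^+ 2 -
    2 * (h * k) * (a - c) * (a + c) + h * (h * k) * (a + c) ^+ 2 by ring.
  have -> : k * ((b - d) - h * (b + d)) ^+ 2 = k * (b - d) ^+ 2 -
    2 * (h * k) * (b - d) * (b + d) + h * (h * k) * (b + d) ^+ 2 by ring.
  by rewrite hk; lra.
Qed.

End Ell2Norm.

(** * Part (1), and the spectral gap in l2 *)

Section Gap.
Variables (R : realType) (L G : groupType) (iota : {multiplicative L -> G}).
Hypotheses (Lcount : countable [set: L]) (Lexact : bi_exact R L)
  (Lex : existential_embedding iota) (Lnam : ~ amenable R L).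

Local Notation H := (range iota).
Local Notation act s := (@coset_act G H (iota s)).

(** Finite index would make the [H]-orbit of the coset [g H] finite; its indicator, invariant and
    zero at the base coset, would contradict the l1 gap. *)
Lemma strongly_self_commensurating_range : strongly_self_commensurating H.
Proof.
move=> g nHg fK; have Hsub := subgroup_range iota.
have [S [eps [eps0 gap]]] := invariant_mean_transfer Lcount Lexact Lex Lnam.
pose O := [set mkcoset H (h * g)%g | h in H].
have fO : finite_set O.
  (* The intersection stabilizes [g H], so [h g H] depends only on the coset of [h] modulo it;
     [xget] picks a representative of that coset. *)
  suff : O `<=` (fun P => mkcoset H (xget 1%g P * g)%g) @`
      [set lcoset h (H `&` lconj g H) | h in H].
    by move/sub_finite_set; apply; exact: finite_image.
  move=> _ [h Hh <-]; exists (lcoset h (H `&` lconj g H)); first by exists h.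
  have : lcoset h (H `&` lconj g H) (xget 1%g (lcoset h (H `&` lconj g H))).
    apply: (@xgetPex _ _ (lcoset h (H `&` lconj g H))); exists h, 1%g; rewrite ?mulg1//.
    have H1 : H 1%g by case/subgroupP: Hsub.
    by split=> //; exists 1%g; rewrite // mulg1 mulgV.
  move=> [k [_ [y Hy <-]] <-]; apply/(mkcosetP Hsub).
  have -> : (h * (g * y * g^-1) * g = h * g * y)%g by rewrite !mulgA mulgVK.
  by rewrite invgM mulgVK; exact: subgroup_inv.
have O1 : ~ O (mkcoset H 1%g).
  move=> [h Hh /(mkcosetP Hsub)]; rewrite mulg1 => /(subgroup_inv Hsub).
  rewrite invgK => Hhg; apply: nHg; rewrite -(mulKg h g).
  by apply: subgroup_mul => //; exact: subgroup_inv.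
have Oact s x : O x -> O (act s x).
  move=> [h Hh <-]; rewrite coset_act_mk mulgA; exists (iota s * h)%g => //.
  by apply: subgroup_mul => //; exists s.
have ind_act s x : \1_O (act s x) = \1_O x :> R.
  rewrite !indicE; congr (_%:R); congr nat_of_bool; apply/idP/idP => /set_mem Ox; apply/mem_set.
    by have := Oact (s^-1)%g _ Ox; rewrite -coset_actM -gmulfM mulVg multiplicative1 coset_act1.
  exact: Oact.
have ind0 x : 0 <= \1_O x :> R by rewrite indicE.
have ind1 : \1_O (mkcoset H 1%g) = 0 :> R by rewrite indicE memNset.
have := gap \1_O ind0 ind1 (nnsum_indic_finite R fO).
rewrite big1 => [|s _]; last first.
  have -> : (fun x => `|\1_O (act s x) - \1_O x|) = fun=> 0 :> R.
    by apply/funext => x; rewrite ind_act subrr normr0.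
  exact: nnsum0.
rewrite leNgt => /negP; apply; rewrite mule_gt0// ?lte_fin//.
have Og : O (mkcoset H g).
  by exists 1%g; rewrite ?mul1g//; case/subgroupP: Hsub.
apply: lt_le_trans (nnsum_ge (mkcoset H g) _); first by rewrite indicE mem_set//= lte_fin.
by move=> x; rewrite indicE.
Qed.

(** The l1 inequality is applied to [|v|^2], and differences of squared moduli are bounded by
    [sqmod_sub_norm]. *)
Lemma spectral_gap : exists (S : seq L) (k : R), 0 < k /\
  forall v : ell2 R (cosets H), v (mkcoset H 1%g) = 0 ->
    k * sqnorm v <= \sum_(s <- S) sqnorm (qr_op (iota s) v - v).
Proof.
have [S [eps [eps0 gap]]] := invariant_mean_transfer Lcount Lexact Lex Lnam.
pose n : R := (size S)%:R; have n0 : 0 <= n by [].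
(* With this weight the terms in [sqnorm v] sum to [2 h n |v|^2 <= (eps / 2) |v|^2], half of the
   left side; [n + 1] avoids dividing by 0. *)
pose h := eps / (4 * (n + 1)).
have h0 : 0 < h by rewrite divr_gt0// mulr_gt0// ltr_wpDl.
(* Inverses appear because [x |-> v (s x)] is the translate of [v] by [s^-1]. *)
exists [seq s^-1%g | s <- S], (eps * h); split; first exact: mulr_gt0.
move=> v v1; rewrite big_map.
have := gap (fun x => sqmod (v x)) (fun x => sqmod_ge0 _) _ (ell2_lt v).
have -> : sqmod (v (mkcoset H 1%g)) = 0 by rewrite v1 /sqmod/= expr0n/= addr0.
move=> /(_ erefl); rewrite -sqnormE -EFinM => gapv.
have bnd s : (nnsum (fun x => `|sqmod (v (act s x)) - sqmod (v x)|%R) <=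
    ((2 * h)^-1 * sqnorm (qr_op (iota s^-1%g) v - v) + h * (2 * sqnorm v))%:E)%E.
  have nv : nnsum (fun x => sqmod (v (act s x))) = (sqnorm v)%:E.
    by rewrite sqnormE (nnsum_coset_act (iota s) (fun x => sqmod (v x))).
  have e : (fun x => sqmod (v (act s x) - v x)) =
      fun x => sqmod ((qr_op (iota s^-1%g) v - v) x).
    by apply/funext => x; rewrite ell2D ell2N /= multiplicativeV invgK.
  have -> : ((2 * h)^-1 * sqnorm (qr_op (iota s^-1%g) v - v) + h * (2 * sqnorm v))%:E =
      (nnsum (fun x => (2 * h)^-1 * sqmod ((qr_op (iota s^-1%g) v - v) x))%R +
       nnsum (fun x => h * (sqmod (v (act s x)) + sqmod (v x)))%R)%E.
    have k0 : 0 <= (2 * h)^-1 by rewrite invr_ge0 mulr_ge0// ltW.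
    rewrite (nnsumZ k0 (fun x => sqmod_ge0 ((qr_op (iota s^-1%g) v - v) x))).
    have vv0 x : 0 <= sqmod (v (act s x)) + sqmod (v x).
      by rewrite addr_ge0 ?sqmod_ge0.
    rewrite (nnsumZ (ltW h0) vv0).
    have -> : nnsum (fun x => sqmod (v (act s x)) + sqmod (v x)) = (2 * sqnorm v)%:E.
      rewrite (nnsumD (a := fun x => sqmod (v (act s x)))) ?nv ?sqnormE//; last 2 first.
      - by move=> x; exact: sqmod_ge0.
      - by move=> x; exact: sqmod_ge0.
      by rewrite -sqnormE -EFinD; congr EFin; ring.
    by rewrite -sqnormE -!EFinM -EFinD.
  apply: nnsum_le_addr => x.
  - by rewrite mulr_ge0 ?(ltW h0)// addr_ge0 ?sqmod_ge0.
  - by rewrite mulr_ge0 ?sqmod_ge0// invr_ge0 mulr_ge0// ltW.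
  rewrite -(congr1 (fun f => f x) e); exact: sqmod_sub_norm.
have : eps * sqnorm v <= \sum_(s <- S)
    ((2 * h)^-1 * sqnorm (qr_op (iota s^-1%g) v - v) + h * (2 * sqnorm v)).
  rewrite -lee_fin (le_trans gapv)// -sumEFin; apply: lee_sum => s _; exact: bnd.
rewrite big_split/= -mulr_sumr big_const_seq count_predT iter_addr_0 -mulr_natr -/n.
set D := \sum_(s <- S) _ => le1.
have he : 4 * h * (n + 1) = eps.
  have n1 : n + 1 != 0 by apply: lt0r_neq0; rewrite ltr_wpDl.
  by rewrite /h; field.
have q0 := sqnorm_ge0 v.
have h2 : 0 < 2 * h by rewrite mulr_gt0.
have le2 : 2 * h * (eps * sqnorm v) <= D + 4 * h * n * (h * sqnorm v).
  apply: le_trans (ler_wpM2l (ltW h2) le1) _.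
  rewrite [leLHS](_ : _ = D + 4 * h * n * (h * sqnorm v))//.
  by field; exact: lt0r_neq0.
have le3 : 4 * h * n * (h * sqnorm v) <= eps * (h * sqnorm v).
  apply: ler_wpM2r; first by rewrite mulr_ge0// ltW.
  by rewrite -he mulrDr mulr1 lerDl mulr_ge0// ltW.
rewrite mulrAC -mulrA; lra.
Qed.

End Gap.

(** * Real inner product and norm of a complex Hilbert space *)

Section Hilbert.
Variables (R : realType) (V : hilbert R).
Implicit Types (u v w : V) (r : R).

(** The real part is a symmetric real bilinear form with the same norm, so that all estimates take
    place in [R]. *)
Definition rip v w : R := complex.Re (hip V v w).

Lemma ripC v w : rip v w = rip w v.
Proof.
have Re_conj (z : R[i]) : complex.Re z^*%C = complex.Re z by case: z.
by rewrite /rip (hermC _ v w) expr0 mul1r; exact: Re_conj.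
Qed.

Lemma ripDl u v w : rip (u + v) w = rip u w + rip v w.
Proof. by rewrite /rip linearDl raddfD. Qed.

Lemma ripDr u v w : rip w (u + v) = rip w u + rip w v.
Proof. by rewrite ripC ripDl !(ripC w). Qed.

Lemma ripZl r v w : rip (Complex r 0 *: v) w = r * rip v w.
Proof.
have Re_scale (z : R[i]) : complex.Re (Complex r 0 * z) = r * complex.Re z.
  by case: z => a b /=; rewrite mul0r subr0.
by rewrite /rip linearZl_LR; exact: Re_scale.
Qed.

Lemma ripZr r v w : rip v (Complex r 0 *: w) = r * rip v w.
Proof. by rewrite ripC ripZl ripC. Qed.

Lemma scaleN1c v : Complex (-1) 0 *: v = - v.
Proof.
by rewrite -scaleN1r; congr (_ *: _); apply/eqP; rewrite eq_complex/= oppr0 !eqxx.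
Qed.

Lemma ripNl v w : rip (- v) w = - rip v w.
Proof. by rewrite -scaleN1c ripZl mulN1r. Qed.

Lemma ripNr v w : rip v (- w) = - rip v w.
Proof. by rewrite ripC ripNl ripC. Qed.

Lemma rip_ge0 v : 0 <= rip v v.
Proof. by have := dnorm_ge0 (hip V) v; rewrite lecE => /andP[_]. Qed.

Lemma hnorm_ge0 v : 0 <= hnorm v. Proof. exact: sqrtr_ge0. Qed.

Lemma hnorm_sqr v : hnorm v ^+ 2 = rip v v.
Proof. by rewrite sqr_sqrtr// rip_ge0. Qed.

Lemma hnorm0 : hnorm (0 : V) = 0.
Proof. by apply/eqP; rewrite -sqrf_eq0 hnorm_sqr -(scale0r 0) ripZl mul0r. Qed.

Lemma hnorm_eq0 v : hnorm v = 0 -> v = 0.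
Proof.
move=> v0; apply/eqP; rewrite -(dnorm_eq0 (hip V)) eq_le dnorm_ge0 andbT.
have := dnorm_ge0 (hip V) v; rewrite !lecE /= => /andP[/eqP -> _].
by rewrite eqxx /= -[leLHS]/(rip v v) -hnorm_sqr v0 expr0n.
Qed.

Lemma hnorm_leP v r : 0 <= r -> rip v v <= r ^+ 2 -> hnorm v <= r.
Proof. by move=> r0; rewrite -hnorm_sqr ler_sqr ?nnegrE// hnorm_ge0. Qed.

Lemma hnormZ r v : 0 <= r -> hnorm (Complex r 0 *: v) = r * hnorm v.
Proof.
move=> r0; apply/eqP; rewrite -(@eqrXn2 _ 2)// ?mulr_ge0 ?hnorm_ge0//.
by rewrite exprMn !hnorm_sqr ripZl ripZr mulrA expr2.
Qed.

Lemma hnormN v : hnorm (- v) = hnorm v.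
Proof.
by apply/eqP; rewrite -(@eqrXn2 _ 2)// ?hnorm_ge0// !hnorm_sqr ripNl ripNr opprK.
Qed.

Lemma hnormB v w : hnorm (v - w) = hnorm (w - v).
Proof. by rewrite -hnormN opprB. Qed.

Lemma hnorm_parallelogram v w :
  hnorm (v + w) ^+ 2 = 2 * (hnorm v ^+ 2 + hnorm w ^+ 2) - hnorm (v - w) ^+ 2.
Proof. by rewrite !hnorm_sqr !(ripDl, ripDr, ripNl, ripNr) (ripC w v); lra. Qed.

(** Cauchy-Schwarz, from the square of [|w| v - |v| w]. If one vector has norm 0 and the inner
    product is positive, subtracting [t] times that vector from the other gives a negative
    square. *)
Lemma rip_le v w : rip v w <= hnorm v * hnorm w.
Proof.
have [v0|v0] := eqVneq (hnorm v) 0; last first.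
  have [w0|w0] := eqVneq (hnorm w) 0.
    rewrite w0 mulr0; have ww : rip w w = 0 by rewrite -hnorm_sqr w0 expr0n.
    have vv := rip_ge0 v; pose t := (rip v v + 1) / rip v w.
    rewrite leNgt; apply/negP => vw.
    have := rip_ge0 (v - Complex t 0 *: w).
    rewrite !(ripDl, ripDr, ripNl, ripNr, ripZl, ripZr) (ripC w v) ww.
    rewrite (_ : t * rip v w = rip v v + 1) ?divfK ?gt_eqF//; lra.
  have := rip_ge0 (Complex (hnorm w) 0 *: v - Complex (hnorm v) 0 *: w).
  rewrite !(ripDl, ripDr, ripNl, ripNr, ripZl, ripZr) (ripC w v) -!hnorm_sqr.
  have v1 : 0 < hnorm v by rewrite lt_neqAle eq_sym v0 hnorm_ge0.
  have w1 : 0 < hnorm w by rewrite lt_neqAle eq_sym w0 hnorm_ge0.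
  move=> H; rewrite -(@ler_pM2l _ (hnorm v * hnorm w)) ?mulr_gt0//; nra.
rewrite v0 mul0r; have vv : rip v v = 0 by rewrite -hnorm_sqr v0 expr0n.
have ww := rip_ge0 w; pose t := (rip w w + 1) / rip v w.
rewrite leNgt; apply/negP => vw.
have := rip_ge0 (w - Complex t 0 *: v).
rewrite !(ripDl, ripDr, ripNl, ripNr, ripZl, ripZr) (ripC w v) vv.
rewrite (_ : t * rip v w = rip w w + 1) ?divfK ?gt_eqF//; lra.
Qed.

Lemma hnormD v w : hnorm (v + w) <= hnorm v + hnorm w.
Proof.
apply: hnorm_leP; first by rewrite addr_ge0 ?hnorm_ge0.
rewrite !(ripDl, ripDr) (ripC w v) -!hnorm_sqr; have := rip_le v w; lra.
Qed.

Lemma hnorm_sum (I : Type) (s : seq I) (F : I -> V) :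
  hnorm (\sum_(i <- s) F i) <= \sum_(i <- s) hnorm (F i).
Proof.
elim: s => [|i s IH]; first by rewrite !big_nil hnorm0.
by rewrite !big_cons (le_trans (hnormD _ _))// lerD2l.
Qed.

End Hilbert.

(** * The group algebra and weak containment *)

Section GroupAlgebra.
Variables (R : realType) (G : groupType).
Implicit Types (pi rho : unitary_rep R G).

Lemma rep_opB pi g (v w : rep_space pi) :
  rep_op g (v - w) = rep_op g v - rep_op g w.
Proof.
by rewrite -scaleN1r addrC rep_linear scaleN1r addrC.
Qed.

Lemma rep_op0 pi g : rep_op g (0 : rep_space pi) = 0.
Proof. by have := rep_opB g (0 : rep_space pi) 0; rewrite !subrr. Qed.

Lemma rep_opD pi g (v w : rep_space pi) :
  rep_op g (v + w) = rep_op g v + rep_op g w.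
Proof. by rewrite -{1}(scale1r v) rep_linear scale1r. Qed.

Lemma rep_opZ pi g c (v : rep_space pi) : rep_op g (c *: v) = c *: rep_op g v.
Proof. by rewrite -{1}[c *: v]addr0 rep_linear rep_op0 addr0. Qed.

Lemma rep_op_sum pi g (I : Type) (s : seq I) (F : I -> rep_space pi) :
  rep_op g (\sum_(i <- s) F i) = \sum_(i <- s) rep_op g (F i).
Proof.
elim: s => [|i s IH]; first by rewrite !big_nil rep_op0.
by rewrite !big_cons rep_opD IH.
Qed.

Lemma hnorm_rep_op pi g (v : rep_space pi) : hnorm (rep_op g v) = hnorm v.
Proof. by rewrite /hnorm /ip_norm rep_unitary. Qed.

(* An element of the group algebra, seen as acting in all representations at once. *)
Definition galg (T : forall pi, rep_space pi -> rep_space pi) :=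
  exists l : seq (R[i] * G), forall pi v,
    T pi v = \sum_(p <- l) p.1 *: rep_op p.2 v.

Lemma galg_op g : galg (fun pi => @rep_op _ _ pi g).
Proof. by exists [:: (1, g)] => pi v; rewrite big_seq1 scale1r. Qed.

Lemma galg_id : galg (fun pi v => v).
Proof. by exists [:: (1, 1%g)] => pi v; rewrite big_seq1 scale1r rep_op1. Qed.

Lemma galgZ c T : galg T -> galg (fun pi v => c *: T pi v).
Proof.
move=> [l lT]; exists [seq (c * p.1, p.2) | p <- l] => pi v.
by rewrite lT scaler_sumr big_map; apply: eq_bigr => p _; rewrite scalerA.
Qed.

Lemma galgD T T' : galg T -> galg T' ->
  galg (fun pi v => T pi v + T' pi v).
Proof.
by move=> [l lT] [l' lT']; exists (l ++ l') => pi v; rewrite lT lT' big_cat.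
Qed.

Lemma galgB T T' : galg T -> galg T' ->
  galg (fun pi v => T pi v - T' pi v).
Proof.
move=> aT /(galgZ (-1)) aT'; have [l lT] := galgD aT aT'.
by exists l => pi v; rewrite -lT scaleN1r.
Qed.

Lemma galg_sum (I : Type) (s : seq I) (F : I -> forall pi, rep_space pi -> rep_space pi) :
  (forall i, galg (F i)) -> galg (fun pi v => \sum_(i <- s) F i pi v).
Proof.
move=> aF; elim: s => [|i s [l lT]].
  by exists [::] => pi v; rewrite !big_nil.
have [l' lT'] := aF i; exists (l' ++ l) => pi v.
by rewrite big_cons lT lT' big_cat.
Qed.

Lemma galg_comp T T' : galg T -> galg T' ->
  galg (fun pi v => T pi (T' pi v)).
Proof.
move=> [l lT] [l' lT']; exists [seq (p.1 * q.1, (p.2 * q.2)%g) | p <- l, q <- l'].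
move=> pi v; rewrite lT big_allpairs_dep; apply: eq_bigr => p _.
rewrite lT' rep_op_sum scaler_sumr; apply: eq_bigr => q _ /=.
by rewrite rep_opZ scalerA rep_opM.
Qed.

Lemma galg_iter n T : galg T -> galg (fun pi => iter n (T pi)).
Proof.
move=> aT; elim: n => [|n IH]; first exact: galg_id.
exact: galg_comp aT IH.
Qed.

(** Lists with repetitions are convenient for sums and products, whereas [rep_opnorm] takes finitely
    supported functions: the coefficients at equal group elements are added up. *)
Lemma galgE T : galg T ->
  exists a : {fsfun G -> R[i] with 0}, forall pi v, T pi v = @rep_alg _ _ pi a v.
Proof.
move=> [l lT].
pose f g : R[i] := \sum_(p <- l | p.2 == g) p.1.
pose a : {fsfun G -> R[i] with 0} :=
  [fsfun g in [fset p.2 | p in l]%fset => f g | 0].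
have aE g : a g = f g.
  rewrite /a fsfunE; case: ifPn => // gl; rewrite /f big1_seq// => p /andP[/eqP pg pl].
  by case/negP: gl; apply/imfsetP; exists p.
exists a => pi v; rewrite lT /rep_alg.
have sub : (finsupp a `<=` [fset p.2 | p in l])%fset by exact: finsupp_sub.
rewrite (big_fset_incl _ sub) /=; last first.
  by move=> g _; rewrite memNfinsupp => /eqP ->; rewrite scale0r.
rewrite [RHS](eq_bigr (fun g =>
    \sum_(p <- l) (if p.2 == g then p.1 *: rep_op g v else 0))); last first.
  by move=> g _; rewrite aE /f scaler_suml big_mkcond.
rewrite exchange_big/= big_seq [RHS]big_seq; apply: eq_bigr => p pl.
have pS : p.2 \in [fset p.2 | p in l]%fset by apply/imfsetP; exists p.
rewrite (big_fsetD1 p.2)//= eqxx big1_fset ?addr0// => g.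
by rewrite !inE eq_sym => /andP[/negPf -> _].
Qed.

(** The form in which weak containment is used: an operator bound checked in [rho] holds in [pi]. *)
Lemma weakly_contained_le pi rho T (C : R) : weakly_contained pi rho ->
  galg T -> 0 <= C ->
  (forall v, hnorm (T rho v) <= C * hnorm v) ->
  forall v, hnorm (T pi v) <= C * hnorm v.
Proof.
move=> wc /galgE[a aT] C0 le_rho v.
have TZ r w : T pi (Complex r 0 *: w) = Complex r 0 *: T pi w.
  rewrite !aT /rep_alg scaler_sumr; apply: eq_bigr => g _.
  by rewrite rep_opZ !scalerA mulrC.
have unit_le w : hnorm w <= 1 -> hnorm (T pi w) <= C.
  move=> w1; rewrite -lee_fin; apply: le_trans (le_trans _ (wc a)) _.
  - by apply: ereal_sup_ubound; exists w; rewrite // -aT.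
  - apply: ge_ereal_sup => _ [u /= u1 <-]; rewrite -aT lee_fin.
    by rewrite (le_trans (le_rho u))// ler_piMr.
(* Dividing by [|v| + e] instead of [|v|] covers the case [v = 0]. *)
have le_eps e : 0 < e -> hnorm (T pi v) <= C * (hnorm v + e).
  move=> e0; have ve : 0 < hnorm v + e by rewrite ltr_wpDl// hnorm_ge0.
  have := unit_le (Complex (hnorm v + e)^-1 0 *: v).
  rewrite TZ !hnormZ ?invr_ge0 ?(ltW ve)// => H.
  rewrite mulrC -ler_pdivrMl//; apply: H.
  by rewrite mulrC ler_pdivrMr// mul1r lerDl ltW.
have [C00|C1] := eqVneq C 0.
  by have := le_eps 1 ltr01; rewrite C00 !mul0r.
have Cp : 0 < C by rewrite lt_neqAle eq_sym C1.
apply/ler_addgt0Pr => e e0; rewrite -(divfK C1 e) [e / C * C]mulrC -mulrDr.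
by apply: le_eps; rewrite divr_gt0.
Qed.

End GroupAlgebra.

(** * Averaging operators *)

Section Averaging.
Variables (R : realType) (G : groupType) (S : seq G).
Implicit Types (pi : unitary_rep R G).

Lemma galg_additive (T : forall pi, rep_space pi -> rep_space pi) pi v w :
  galg T -> T pi (v + w) = T pi v + T pi w.
Proof.
move=> [l lT]; rewrite !lT -big_split; apply: eq_bigr => p _.
by rewrite rep_opD scalerDr.
Qed.

(** The mean of the operators [(1 + s) / 2]. Unlike [s], each of these shortens [v] as soon as [s]
    moves it, so no eigenvalue near -1 has to be excluded. *)
Definition avg pi (v : rep_space pi) : rep_space pi :=
  Complex (size S)%:R^-1 0 *: \sum_(s <- S) Complex 2^-1 0 *: (v + rep_op s v).

Lemma galg_avg : galg avg.
Proof.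
exact: (galgZ _ (galg_sum S (fun s => galgZ _
  (galgD (galg_id R G) (galg_op R s))))).
Qed.

Hypothesis S0 : (0 < size S)%N.

Let N0 : 0 < (size S)%:R :> R. Proof. by rewrite ltr0n. Qed.

Lemma scale_invn (V : lmodType R[i]) n (v : V) : (0 < n)%N ->
  Complex n%:R^-1 0 *: (v *+ n) = v.
Proof.
move=> n0; rewrite -[v *+ n]scaler_nat scalerA -[RHS]scale1r; congr (_ *: _).
rewrite -(rmorph_nat (real_complex R)) -[Complex _ 0]/(real_complex R _) -rmorphM.
by rewrite mulVf ?rmorph1// pnatr_eq0 -lt0n.
Qed.

Lemma avg_fixed pi (v : rep_space pi) :
  (forall s, s \in S -> rep_op s v = v) -> avg v = v.
Proof.
move=> Sv; rewrite /avg (eq_big_seq (fun=> v)) => [|s sS]; last first.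
  by rewrite Sv// -mulr2n scale_invn.
by rewrite big_const_seq count_predT iter_addr_0 scale_invn.
Qed.

Lemma rip_avg pi (v u : rep_space pi) :
  (forall s, s \in S -> rep_op s u = u) -> rip (avg v) u = rip v u.
Proof.
move=> Su; rewrite /avg ripZl.
have rip_suml (s : seq G) (F : G -> rep_space pi) :
    rip (\sum_(i <- s) F i) u = \sum_(i <- s) rip (F i) u.
  elim: s => [|i s IH]; last by rewrite !big_cons ripDl IH.
  by rewrite !big_nil -(scale0r 0) ripZl mul0r.
rewrite rip_suml (eq_big_seq (fun=> rip v u)) => [|s sS]; last first.
  rewrite ripZl ripDl -{2}(Su s sS) /rip rep_unitary -/(rip v u); lra.
rewrite big_const_seq count_predT iter_addr_0 -[rip v u *+ _]mulr_natr mulrCA mulVf ?mulr1//.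
by rewrite gt_eqF.
Qed.

(** By the parallelogram identity, [|(v + s v) / 2|^2 = |v|^2 - |s v - v|^2 / 4]; the gap bounds the
    total loss over [S] from below. *)
Lemma avg_contract pi (v : rep_space pi) (k : R) : 0 <= k ->
  k * hnorm v ^+ 2 <= \sum_(s <- S) hnorm (rep_op s v - v) ^+ 2 ->
  hnorm (avg v) <= (1 - k / (8 * (size S)%:R)) * hnorm v.
Proof.
move=> k0 gap; pose x s := hnorm (Complex 2^-1 0 *: (v + rep_op s v)).
have x0 s : 0 <= x s by exact: hnorm_ge0.
have xE s : x s ^+ 2 = hnorm v ^+ 2 - 4^-1 * hnorm (rep_op s v - v) ^+ 2.
  rewrite /x hnormZ// exprMn (hnorm_parallelogram v) hnorm_rep_op (hnormB v).
  by field.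
have avgx : (size S)%:R * hnorm (avg v) <= \sum_(s <- S) x s.
  rewrite /avg hnormZ ?invr_ge0 ?(ltW N0)// mulrA divff ?gt_eqF// mul1r.
  exact: hnorm_sum.
have [v0|v0] := eqVneq (hnorm v) 0.
  rewrite v0 mulr0 -(pmulr_rle0 _ N0) (le_trans avgx)//.
  rewrite big1// => s _; apply/eqP; rewrite -sqrf_eq0 eq_le sqr_ge0 andbT.
  rewrite xE v0 expr0n/= sub0r oppr_le0 mulr_ge0// ?sqr_ge0//.
have vp : 0 < hnorm v by rewrite lt_neqAle eq_sym v0 hnorm_ge0.
(* AM-GM: [8 |v| x <= 4 |v|^2 + 4 x^2 = 8 |v|^2 - |s v - v|^2] *)
have le8 : 8 * hnorm v * \sum_(s <- S) x s <=
    \sum_(s <- S) (8 * hnorm v ^+ 2 - hnorm (rep_op s v - v) ^+ 2).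
  rewrite mulr_sumr; apply: ler_sum => s _.
  have := sqr_ge0 (hnorm v - x s); have := xE s; nra.
move: le8; rewrite big_split/= sumrN big_const_seq count_predT iter_addr_0 -[(8 * _) *+ _]mulr_natr.
set D := \sum_(s <- S) hnorm _ ^+ 2 in gap *.
move=> le8; set n : R := (size S)%:R in avgx le8 *.
have n0 : 0 < n by exact: N0.
have : 8 * hnorm v * (n * hnorm (avg v)) <= 8 * hnorm v ^+ 2 * n - k * hnorm v ^+ 2.
  apply: le_trans (ler_wpM2l _ avgx) _; first by rewrite mulr_ge0// ltW.
  lra.
have -> : 8 * hnorm v ^+ 2 * n - k * hnorm v ^+ 2 =
    8 * hnorm v * (n * ((1 - k / (8 * n)) * hnorm v)).
  by field; exact: lt0r_neq0.
by rewrite !ler_pM2l// mulr_gt0.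
Qed.

End Averaging.

(** * Transfer of the gap to a weakly equivalent representation *)

Section Transfer.
Variables (R : realType) (G : groupType) (H : set G) (S : seq G) (k : R).
Hypotheses (Hsub : subgroup H) (S0 : (0 < size S)%N)
  (SH : forall s, s \in S -> H s) (k0 : 0 < k).
Hypothesis gap : forall v : ell2 R (cosets H), v (mkcoset H 1%g) = 0 ->
  k * sqnorm v <= \sum_(s <- S) sqnorm (qr_op s v - v).

Local Notation pi := (quasi_regular R H).
Local Notation base := (mkcoset H 1%g).
Local Notation T p := (@avg R G S p).

(** The contraction factor of the average off the base coset; the maximum keeps it nonnegative
    however large [k] is. *)
Let c : R := Num.max 0 (1 - k / (8 * (size S)%:R)).

Let c0 : 0 <= c. Proof. by rewrite le_max lexx. Qed.

Let c1 : c < 1.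
Proof.
rewrite gt_max ltr01/= gtrBl divr_gt0// mulr_gt0// ltr0n; exact: S0.
Qed.

Let expc_lt (e : R) : 0 < e -> exists n, c ^+ n < e.
Proof.
move=> e0; have /cvgrPdist_lt/(_ e e0) : (fun n => c ^+ n) @ \oo --> (0 : R).
  by apply: cvg_expr; rewrite ger0_norm.
by move=> [n _ /(_ n (leqnn n))]/=; rewrite sub0r normrN ger0_norm ?exprn_ge0//; exists n.
Qed.

Definition off_base (v : rep_space pi) := (v : ell2 R (cosets H)) base = 0.

Lemma coset_act_base h : H h -> coset_act h base = base.
Proof.
by move=> Hh; rewrite coset_act_mk mulg1; apply/(mkcosetP Hsub); rewrite mulg1; exact: subgroup_inv.
Qed.

Lemma off_base_op h v : H h -> off_base v -> off_base (rep_op h v).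
Proof.
move=> Hh v0; rewrite /off_base /= coset_act_base//; exact: subgroup_inv.
Qed.

Lemma off_base_avg v : off_base v -> off_base (T pi v).
Proof.
move=> v0; rewrite /avg.
have offZ a (w : rep_space pi) : off_base w -> off_base (a *: w).
  by move=> w0; exact: etrans (congr1 ( *%R a) w0) (mulr0 a).
have offD (u w : rep_space pi) : off_base u -> off_base w -> off_base (u + w).
  by move=> u0 w0; exact: etrans (congr2 +%R u0 w0) (addr0 0).
apply: (offZ); rewrite big_seq.
apply: (big_ind (fun w : rep_space pi => off_base w)) => // s sS.
by apply: offZ; apply: offD => //; apply: off_base_op => //; exact: SH.
Qed.

Lemma off_base_iter n v : off_base v -> off_base (iter n (T pi) v).
Proof. by move=> v0; elim: n => //= n IH; exact: off_base_avg. Qed.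

Lemma hnorm_avg_off_base v : off_base v -> hnorm (T pi v) <= c * hnorm v.
Proof.
move=> v0; apply: le_trans (avg_contract S0 (ltW k0) _) _.
  rewrite [X in _ * X]ell2_hnorm_sqr; apply: le_trans (gap v0) _.
  by rewrite le_eqVlt; apply/orP; left; apply/eqP/eq_bigr => s _; rewrite -ell2_hnorm_sqr.
by rewrite ler_wpM2r ?hnorm_ge0// le_max lexx orbT.
Qed.

Lemma hnorm_iter_off_base n v : off_base v ->
  hnorm (iter n (T pi) v) <= c ^+ n * hnorm v.
Proof.
move=> v0; elim: n => [|n IH]; first by rewrite mul1r.
rewrite iterS (le_trans (hnorm_avg_off_base _))//; first exact: off_base_iter.
by rewrite exprS -mulrA ler_wpM2l.
Qed.

Lemma base_part_subproof (v : ell2 R (cosets H)) :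
  (fun x => if x == base then v x else 0) \in @square_summable R (cosets H).
Proof.
apply/asboolP; apply: le_lt_trans (ell2_lt v); apply: le_nnsum => x.
by case: ifP => // _; rewrite /sqmod/= expr0n/= addr0 sqmod_ge0.
Qed.

(** The projection [p] onto the line of functions supported at the base coset, to which the powers
    of the average converge in norm. *)
Definition base_part (v : rep_space pi) : rep_space pi := Ell2 (base_part_subproof v).

Lemma off_base_rest v : off_base (v - base_part v).
Proof.
transitivity ((v : ell2 R (cosets H)) base - (base_part v : ell2 R (cosets H)) base) => //.
by rewrite /= eqxx; exact: subrr.
Qed.

Lemma hnorm_base_part v : hnorm (base_part v) <= hnorm v.
Proof.
rewrite !ell2_hnormE ler_wsqrtr// -lee_fin !sqnormE; apply: le_nnsum => x /=.
by case: ifP => // _; rewrite /sqmod/= expr0n/= addr0 sqmod_ge0.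
Qed.

Lemma hnorm_rest v : hnorm (v - base_part v) <= hnorm v.
Proof.
rewrite !ell2_hnormE ler_wsqrtr// -lee_fin !sqnormE; apply: le_nnsum => x.
have -> : (v - base_part v : ell2 R (cosets H)) x =
    if x == base then 0 else (v : ell2 R (cosets H)) x.
  transitivity ((v : ell2 R (cosets H)) x - (base_part v : ell2 R (cosets H)) x) => //.
  by rewrite /=; case: ifP => _; [exact: subrr|exact: subr0].
by case: ifP => // _; rewrite /sqmod/= expr0n/= addr0 sqmod_ge0.
Qed.

Lemma base_part_fixed h v : H h -> rep_op h (base_part v) = base_part v.
Proof.
move=> Hh; apply/val_inj/funext => x /=.
have -> : (coset_act h^-1 x == base) = (x == base).
  apply/eqP/eqP => [hx|->]; last by rewrite coset_act_base//; exact: subgroup_inv.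
  by have := congr1 (coset_act h) hx; rewrite -coset_actM mulgV coset_act1 coset_act_base.
have [->|//] := eqVneq x base; rewrite coset_act_base//; exact: subgroup_inv.
Qed.

Lemma avg_base_part v : T pi (base_part v) = base_part v.
Proof. by apply: avg_fixed => // s sS; apply: base_part_fixed; exact: SH. Qed.

Lemma off_base_translate g v : ~ H g -> off_base (rep_op g (base_part v)).
Proof.
move=> nHg; rewrite /off_base /=; case: ifP => // /eqP.
by rewrite coset_act_mk mulg1 => /(mkcosetP Hsub); rewrite mulg1 invgK => /nHg.
Qed.

Lemma iter_avg_split n v :
  iter n (T pi) v = base_part v + iter n (T pi) (v - base_part v).
Proof.
have e : v = base_part v + (v - base_part v) by rewrite addrC subrK.
rewrite [in LHS]e (galg_additive _ _ (galg_iter n (galg_avg R S))).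
suff -> : iter n (T pi) (base_part v) = base_part v by [].
by elim: n => //= n ->; exact: avg_base_part.
Qed.

Lemma hnorm_iter_rest n v : hnorm (iter n (T pi) (v - base_part v)) <= c ^+ n * hnorm v.
Proof.
apply: le_trans (hnorm_iter_off_base n (off_base_rest v)) _.
by rewrite ler_wpM2l ?exprn_ge0// hnorm_rest.
Qed.

Variable rho : unitary_rep R G.
Hypothesis wc1 : weakly_contained rho pi.

(** In [pi] the two base parts cancel and both remainders have size at most [c ^+ n |v|]; weak
    containment carries the bound to [rho], where no projection is at hand. *)
Lemma hnorm_iter_sub n m (v : rep_space rho) : (n <= m)%N ->
  hnorm (iter n (T rho) v - iter m (T rho) v) <= 2 * c ^+ n * hnorm v.
Proof.
move=> nm; move: v; apply: (weakly_contained_le wc1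
  (galgB (galg_iter n (galg_avg R S)) (galg_iter m (galg_avg R S)))).
  by rewrite mulr_ge0// exprn_ge0.
move=> v; rewrite (iter_avg_split n) (iter_avg_split m) opprD addrACA subrr add0r.
apply: le_trans (hnormD _ _) _; rewrite hnormN.
have := hnorm_iter_rest n v; have := hnorm_iter_rest m v.
have : c ^+ m <= c ^+ n by rewrite ler_wiXn2l// ltW.
have := hnorm_ge0 v; nra.
Qed.

(** The relation [t p = p], up to an error that tends to 0 with [n]. *)
Lemma hnorm_iter_inv n t (v : rep_space rho) : H t ->
  hnorm (rep_op t (iter n (T rho) v) - iter n (T rho) v) <= 2 * c ^+ n * hnorm v.
Proof.
move=> Ht; move: v; apply: (weakly_contained_le wc1
  (galgB (galg_comp (galg_op R t) (galg_iter n (galg_avg R S))) (galg_iter n (galg_avg R S)))).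
  by rewrite mulr_ge0// exprn_ge0.
move=> v; rewrite (iter_avg_split n) rep_opD base_part_fixed// opprD addrACA subrr add0r.
apply: le_trans (hnormD _ _) _; rewrite hnormN hnorm_rep_op.
have := hnorm_iter_rest n v; lra.
Qed.

(** The relation [p g p = 0], up to an error: [g] moves the base part off the base, where the outer
    power shrinks it, and on the rest the inner power is already small. *)
Lemma hnorm_iter_translate n g (v : rep_space rho) : ~ H g ->
  hnorm (iter n (T rho) (rep_op g (iter n (T rho) v))) <= 2 * c ^+ n * hnorm v.
Proof.
move=> nHg; move: v; apply: (weakly_contained_le wc1
  (galg_comp (galg_iter n (galg_avg R S)) (galg_comp (galg_op R g) (galg_iter n (galg_avg R S))))).
  by rewrite mulr_ge0// exprn_ge0.
have cn1 : c ^+ n <= 1 by rewrite exprn_ile1// ltW.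
have cn0 : 0 <= c ^+ n by rewrite exprn_ge0.
have contr (w : rep_space pi) : hnorm (iter n (T pi) w) <= hnorm w.
  elim: (n) => //= m IH; apply: le_trans _ IH; rewrite /avg hnormZ ?invr_ge0//.
  rewrite -(@ler_pM2l _ (size S)%:R) ?ltr0n; last exact: S0.
  rewrite mulrA divff ?pnatr_eq0 -?lt0n; last exact: S0.
  rewrite mul1r (le_trans (hnorm_sum _ _))//.
  apply: (@le_trans _ _ (\sum_(s <- S) hnorm (iter m (T pi) w))).
    apply: ler_sum => s _; rewrite hnormZ ?invr_ge0//.
    by have := hnormD (iter m (T pi) w) (rep_op s (iter m (T pi) w)); rewrite hnorm_rep_op; lra.
  by rewrite big_const_seq count_predT iter_addr_0 mulr_natl.
move=> v; rewrite [in rep_op g _](iter_avg_split n) rep_opD.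
rewrite (galg_additive _ _ (galg_iter n (galg_avg R S))).
apply: le_trans (hnormD _ _) _.
have := hnorm_iter_off_base n (off_base_translate v nHg); rewrite hnorm_rep_op.
have := contr (rep_op g (iter n (T pi) (v - base_part v))); rewrite hnorm_rep_op.
have := hnorm_iter_rest n v; have := hnorm_base_part v; have := hnorm_ge0 v; nra.
Qed.

(** Powers of the average fix [u] and preserve inner products with it, so [<g u, u> = <T^n g T^n u,
    u> <= 2 c^n |u|^2]. *)
Lemma rip_translate_le0 g (u : rep_space rho) : ~ H g ->
  (forall h, H h -> rep_op h u = u) -> rip (rep_op g u) u <= 0.
Proof.
move=> nHg Hu; have Su s : s \in S -> rep_op s u = u by move=> sS; apply/Hu/SH.
have iter_u n : iter n (T rho) u = u by elim: n => //= n ->; exact: avg_fixed.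
have rip_iter n (v : rep_space rho) : rip (iter n (T rho) v) u = rip v u.
  by elim: n => //= n IH; rewrite rip_avg.
have bound n : rip (rep_op g u) u <= 2 * c ^+ n * hnorm u * hnorm u.
  rewrite -(rip_iter n) (le_trans (rip_le _ _))// ler_wpM2r ?hnorm_ge0//.
  by have := hnorm_iter_translate n u nHg; rewrite iter_u.
apply/ler_addgt0Pr => e e0; rewrite add0r.
have d0 : 0 < 2 * hnorm u * hnorm u + 1.
  by rewrite ltr_wpDl// !mulr_ge0// hnorm_ge0.
have [n cn] := expc_lt (divr_gt0 e0 d0); apply: le_trans (bound n) _.
have cn0 : 0 <= c ^+ n by rewrite exprn_ge0.
have : c ^+ n * (2 * hnorm u * hnorm u + 1) < e by rewrite -ltr_pdivlMr.
by have := hnorm_ge0 u; nra.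
Qed.

Hypothesis wc2 : weakly_contained pi rho.

Lemma delta_subproof :
  (fun x => if x == base then 1 else 0) \in @square_summable R (cosets H).
Proof.
apply/asboolP; apply: le_lt_trans (nnsum_indic_finite R (finite_set1 base)).
apply: le_nnsum => x; rewrite indicE; have [->|_] := eqVneq x base.
  by rewrite mem_set// /sqmod/= expr0n/= addr0 expr1n.
by rewrite /sqmod/= expr0n/= addr0.
Qed.

Definition delta : rep_space pi := Ell2 delta_subproof.

Lemma base_part_delta : base_part delta = delta.
Proof. by apply/val_inj/funext => x /=; case: ifP => [->|]. Qed.

Lemma hnorm_delta : 0 < hnorm delta.
Proof.
rewrite ell2_hnormE sqrtr_gt0 -lte_fin sqnormE.
apply: lt_le_trans (nnsum_ge base _); last by move=> x; exact: sqmod_ge0.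
by rewrite /= eqxx /sqmod/= expr0n/= addr0 expr1n lte_fin.
Qed.

(** The iterates of the average on a vector [w] are Cauchy, and their limit is invariant by
    [hnorm_iter_inv]. It is nonzero for a suitable [w]: if the [n]-th power had norm at most 1/2 in
    [rho], it would in [pi], where it fixes [delta]. *)
Lemma exists_invariant_vector : exists l : rep_space rho,
  l != 0 /\ forall h, H h -> rep_op h l = l.
Proof.
(* With 1/8, later iterates differ from [T^n w] by at most [2 c^n |w| <= |w| / 4 < |T^n w| / 2],
   hence keep half of its norm. *)
have [n cn] : exists n, c ^+ n < 8^-1 by apply: expc_lt.
have [w hw] : exists w : rep_space rho, 2^-1 * hnorm w < hnorm (iter n (T rho) w).
  apply: contrapT => nw.
  have := @weakly_contained_le _ _ pi rho _ 2^-1 wc2 (galg_iter n (galg_avg R S)) _ _ delta.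
  have -> : iter n (T pi) delta = delta.
    by elim: (n) => //= m ->; rewrite -base_part_delta avg_base_part.
  move=> H2; have dl0 := hnorm_delta.
  suff : hnorm delta <= 2^-1 * hnorm delta by lra.
  apply: H2 => // v; rewrite leNgt; apply/negP => vv; apply: nw; by exists v.
pose u m := iter m (T rho) w.
have w0 := hnorm_ge0 w.
have d0 : 0 < 4 * hnorm w + 1 by rewrite ltr_wpDl// mulr_ge0.
have cauchy_u (e : R) : 0 < e -> exists N, forall m m', (N <= m)%N -> (N <= m')%N ->
    hnorm (u m - u m') < e.
  move=> e0; have [N cN] := expc_lt (divr_gt0 e0 d0); exists N => m m' Nm Nm'.
  have cN' : c ^+ N * (4 * hnorm w + 1) < e by rewrite -ltr_pdivlMr.
  have cN0 : 0 <= c ^+ N by rewrite exprn_ge0.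
  have := hnormD (u m - u N) (u N - u m'); rewrite addrA subrK (hnormB (u m)).
  have := hnorm_iter_sub w Nm; have := hnorm_iter_sub w Nm'.
  by rewrite -/(u m) -/(u m') -/(u N); nra.
have [l lu] := hcomplete cauchy_u.
have near_l (e : R) : 0 < e -> exists N, forall m, (N <= m)%N -> hnorm (u m - l) < e.
  move=> e0; have /cvgrPdist_lt/(_ e e0)[N _ NP] := lu; exists N => m Nm.
  by have := NP m Nm; rewrite /= sub0r normrN ger0_norm// hnorm_ge0.
have un0 : 0 < hnorm (u n) by apply: le_lt_trans hw; rewrite mulr_ge0.
have lower m : (n <= m)%N -> 2^-1 * hnorm (u n) <= hnorm (u m).
  move=> nm; have := hnorm_iter_sub w nm; rewrite -/(u m) -/(u n) => H1.
  have := hnormD (u n - u m) (u m); rewrite subrK.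
  have : c ^+ n * hnorm w <= 8^-1 * hnorm w by rewrite ler_wpM2r// ltW.
  by move: hw; rewrite -/(u n); lra.
exists l; split.
  have [|N NP] := near_l (4^-1 * hnorm (u n)); first by rewrite mulr_gt0.
  apply/eqP => l0; have := NP _ (leq_maxr n N); rewrite l0 subr0.
  by have := lower _ (leq_maxl n N); lra.
move=> h Hh; apply/eqP; rewrite -subr_eq0; apply/eqP/hnorm_eq0/le_anti.
rewrite hnorm_ge0 andbT; apply/ler_addgt0Pr => e e0; rewrite add0r.
have [|N NP] := near_l (e / 4); first by rewrite divr_gt0.
have [M cM] := expc_lt (divr_gt0 e0 d0).
pose m := maxn N M.
have um : hnorm (u m - l) < e / 4 by apply: NP; exact: leq_maxl.
have cm : c ^+ m * (4 * hnorm w + 1) < e.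
  rewrite -ltr_pdivlMr//; apply: le_lt_trans cM.
  by rewrite ler_wiXn2l ?leq_maxr// ltW.
have cm0 : 0 <= c ^+ m by rewrite exprn_ge0.
have -> : rep_op h l - l = rep_op h (l - u m) + ((rep_op h (u m) - u m) + (u m - l)).
  by rewrite rep_opB !addrA !subrK.
apply: le_trans (hnormD _ _) _; rewrite hnorm_rep_op (hnormB l).
have := hnormD (rep_op h (u m) - u m) (u m - l).
have := hnorm_iter_inv m w Hh; rewrite -/(u m).
nra.
Qed.

End Transfer.

(** Chebyshev's inequality: a finite subset of [O] has at most [|v|^2 / a] points. *)
Lemma finite_level_set (R : realType) (X : choiceType) (v : ell2 R X) (O : set X) (a : R) :
  0 < a -> (forall x, O x -> a <= sqmod (v x)) -> finite_set O.
Proof.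
move=> a0 Oa; apply: contrapT => /(infinite_set_fset (Num.bound (sqnorm v / a)))[B BO cB].
have : a * #|` B|%:R <= sqnorm v.
  have -> : a * #|` B|%:R = \sum_(x <- B) a.
    by rewrite big_const_seq count_predT iter_addr_0 mulr_natr.
  have sq0 x : 0 <= sqmod (v x) by exact: sqmod_ge0.
  have : (nnsum (fun x => (sqmod (v x) * \1_[set` B] x)%R) <= (sqnorm v)%:E)%E.
    rewrite sqnormE; apply: le_nnsum => x; rewrite indicE.
    by case: (x \in [set` B]); rewrite ?mulr1 ?mulr0.
  rewrite nnsum_finite// lee_fin fsbig_finite//= set_fsetK; apply: le_trans.
  by rewrite big_seq [leRHS]big_seq; apply: ler_sum => x xB; apply: Oa; exact: BO.
rewrite mulrC -ler_pdivlMr//; apply/negP; rewrite -ltNge.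
apply: lt_le_trans (_ : (Num.bound (sqnorm v / a))%:R <= _); last by rewrite ler_nat.
by apply: archi_boundP; rewrite divr_ge0 ?sqnorm_ge0// ltW.
Qed.

(** * Conjugation and commensurability of subgroups *)

Section Commensuration.
Variable G : groupType.
Implicit Types (A B H : set G) (g : G).

Lemma lconj_subgroup g H : subgroup H -> subgroup (lconj g H).
Proof.
move=> /subgroupP[H1 HB]; apply/subgroupP; split.
  by exists 1%g; rewrite // mulg1 mulgV.
move=> _ _ [x Hx <-] [y Hy <-]; exists (x / y)%g; first exact: HB.
by rewrite !invgM invgK !mulgA mulgVK.
Qed.

Lemma lconjM g h H : lconj (g * h)%g H = lconj g (lconj h H).
Proof.
by rewrite /lconj image_comp; apply: eq_imagel => x _ /=; rewrite invgM !mulgA.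
Qed.

Lemma lconj1 H : lconj 1%g H = H.
Proof.
rewrite /lconj (_ : (fun x => 1 * x * 1^-1)%g = id) ?image_id//.
by apply/funext => x; rewrite mul1g invg1 mulg1.
Qed.

Lemma conjugate_sym A B : conjugate A B -> conjugate B A.
Proof. by move=> [g ->]; exists (g^-1)%g; rewrite -lconjM mulVg lconj1. Qed.

(* [b (A & k A k^-1)] is recovered from the cosets [b A] and [b k A]. *)
Lemma finite_index_self_commensurating A B :
  subgroup A -> subgroup B -> A `<=` B -> finite_index A B ->
  self_commensurating A -> A = B.
Proof.
move=> sA sB AB fAB cA; apply/seteqP; split=> // k Bk.
pose P := [set lcoset b A | b in B].
(* A general [C] serves both indices in the commensurator: [A] and [k A k^-1]. *)
have fin (C : set G) : C `<=` B -> finite_index (A `&` lconj k A) C.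
  move=> CB; have fPP : finite_set (P `*` P) by exact: finite_setX.
  apply: (sub_finite_set _ (finite_image (fun p : set G * set G =>
    [set x | p.1 x /\ p.2 (x * k)%g]) fPP)) => _ [b Cb <-].
  exists (lcoset b A, lcoset (b * k)%g A).
    split; first by exists b => //; exact: CB.
    by exists (b * k)%g => //; apply: subgroup_mul => //; exact: CB.
  apply/seteqP; split=> [x /= [[y Ay yx] [z Az zx]]|_ [y [Ay [z Az zy]] <-]].
    exists y => //; split=> //; exists z => //.
    by apply: (@mulgI _ b); rewrite yx !mulgA zx mulgK.
  split; first by exists y.
  by exists z; rewrite // -zy !mulgA mulgVK.
rewrite -cA; split; apply: fin => //.
move=> _ [y Ay <-]; apply: subgroup_mul => //; last exact: subgroup_inv.
by apply: subgroup_mul => //; exact: AB.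
Qed.

End Commensuration.

(** * Quasi-regular representations of conjugate subgroups *)

Section ConjugateEquivalent.
Variables (R : realType) (G : groupType) (H : set G) (g : G).

(* [x (g H g^-1) -> x g H] is an equivariant bijection of the coset spaces. *)
Lemma coset_conj_subproof (C : cosets (lconj g H)) :
  [set (x * g)%g | x in \val C] \in cosets H.
Proof.
have [x _ xC] := set_mem (valP C); apply/mem_set; exists (x * g)%g => //.
rewrite -xC /lcoset /lconj !image_comp; apply: eq_imagel => y _ /=.
by rewrite !mulgA mulgVK.
Qed.

Definition coset_conj (C : cosets (lconj g H)) : cosets H :=
  SigSub (coset_conj_subproof C).

Lemma coset_conj_inv_subproof (D : cosets H) :
  [set (x * g^-1)%g | x in \val D] \in cosets (lconj g H).
Proof.
have [x _ xD] := set_mem (valP D); apply/mem_set; exists (x * g^-1)%g => //.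
rewrite -xD /lcoset /lconj !image_comp; apply: eq_imagel => y _ /=.
by rewrite !mulgA mulgVK.
Qed.

Definition coset_conj_inv (D : cosets H) : cosets (lconj g H) :=
  SigSub (coset_conj_inv_subproof D).

Lemma coset_conjK : cancel coset_conj coset_conj_inv.
Proof.
move=> C; apply: val_inj => /=; rewrite image_comp -[RHS]image_id.
by apply: eq_imagel => x _ /=; rewrite mulgK.
Qed.

Lemma coset_conj_invK : cancel coset_conj_inv coset_conj.
Proof.
move=> C; apply: val_inj => /=; rewrite image_comp -[RHS]image_id.
by apply: eq_imagel => x _ /=; rewrite mulgVK.
Qed.

Lemma coset_conj_act h C : coset_conj (coset_act h C) = coset_act h (coset_conj C).
Proof.
apply: val_inj => /=; rewrite /lcoset !image_comp; apply: eq_imagel => x _ /=.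
by rewrite mulgA.
Qed.

Lemma nnsum_coset_conj (a : cosets H -> R) :
  nnsum (fun C => a (coset_conj C)) = nnsum a.
Proof. exact: nnsum_bij coset_conjK coset_conj_invK. Qed.

Lemma conj_ell2_subproof (f : ell2 R (cosets H)) :
  (fun C => f (coset_conj C)) \in @square_summable R (cosets (lconj g H)).
Proof.
by apply/asboolP; rewrite (nnsum_coset_conj (fun C => sqmod (f C))); exact: ell2_lt.
Qed.

Definition conj_ell2 (f : ell2 R (cosets H)) : ell2 R (cosets (lconj g H)) :=
  Ell2 (conj_ell2_subproof f).

(** Composition with [coset_conj] is an isometry intertwining the two representations. *)
Lemma weakly_contained_conj :
  weakly_contained (quasi_regular R H) (quasi_regular R (lconj g H)).
Proof.
move=> a; apply: ge_ereal_sup => _ [v /= v1 <-].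
have hn (w : ell2 R (cosets H)) :
    hnorm (H := ell2_hilbert R (cosets (lconj g H))) (conj_ell2 w) =
    hnorm (H := ell2_hilbert R (cosets H)) w.
  by rewrite !ell2_hnormE /sqnorm (nnsum_coset_conj (fun C => sqmod (w C))).
have intertwine : rep_alg a (conj_ell2 v : rep_space (quasi_regular R (lconj g H))) =
    conj_ell2 (rep_alg a v).
  rewrite /rep_alg; elim/big_rec2: _ => [|h w w' _ ->]; first exact: val_inj.
  apply/val_inj/funext => C; congr (_ + _) => //.
  exact: (congr1 (fun D => a h * (v : ell2 R (cosets H)) D) (coset_conj_act h^-1 C)).
apply: ereal_sup_ubound; exists (conj_ell2 v : rep_space (quasi_regular R (lconj g H))).
  by rewrite /= [leLHS]hn.
by rewrite intertwine; congr EFin; exact: hn.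
Qed.

End ConjugateEquivalent.

Lemma conjugate_weakly_equivalent (R : realType) (G : groupType) (A B : set G) :
  conjugate A B -> weakly_equivalent (quasi_regular R A) (quasi_regular R B).
Proof.
move=> AB; split; last by have [g ->] := conjugate_sym AB; exact: weakly_contained_conj.
by have [g ->] := AB; exact: weakly_contained_conj.
Qed.

(** * Part (2): from weak equivalence to conjugacy *)

Section Rigidity.
Variables (R : realType) (L G : groupType) (iota : {multiplicative L -> G}).
Hypotheses (Lcount : countable [set: L]) (Lexact : bi_exact R L)
  (Lex : existential_embedding iota) (Lnam : ~ amenable R L).

Local Notation H := (range iota).

Lemma modulus_subproof (X : choiceType) (l : ell2 R X) :
  (fun x => Complex (Num.sqrt (sqmod (l x))) 0) \in @square_summable R X.
Proof.
apply/asboolP; apply: le_lt_trans (ell2_lt l); apply: le_nnsum => x.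
by rewrite /sqmod/= sqr_sqrtr ?sqmod_ge0// expr0n/= addr0.
Qed.

(** The pointwise absolute value inherits invariance and makes every term of [<g u, u>]
    nonnegative. *)
Definition modulus (X : choiceType) (l : ell2 R X) : ell2 R X := Ell2 (modulus_subproof l).

Lemma weakly_equivalent_conjugate (L' : set G) :
  subgroup L' -> self_commensurating L' ->
  weakly_equivalent (quasi_regular R H) (quasi_regular R L') -> conjugate H L'.
Proof.
move=> sL' cL' [wc2 wc1]; have sH := subgroup_range iota.
have [S1 [k [k0 gap1]]] := spectral_gap Lcount Lexact Lex Lnam.
(* Adding the unit makes [S] nonempty, as averaging requires, and keeps the gap. *)
pose S := [seq iota s | s <- 1%g :: S1].
have S0 : (0 < size S)%N by [].
have SH s : s \in S -> H s by move=> /mapP[t _ ->]; exists t.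
have gap (v : ell2 R (cosets H)) : v (mkcoset H 1%g) = 0 ->
    k * sqnorm v <= \sum_(s <- S) sqnorm (qr_op s v - v).
  by move=> v0; rewrite big_map big_cons (le_trans (gap1 v v0))// lerDr sqnorm_ge0.
have [l [l0 lH]] := exists_invariant_vector sH S0 SH k0 gap wc1 wc2.
pose lf : ell2 R (cosets L') := l.
have linv h (x : cosets L') : H h ->
    lf (coset_act h x) = lf x.
  move=> Hh; have := congr1 (fun f : ell2 R (cosets L') => f x) (lH _ (subgroup_inv sH Hh)).
  by rewrite /= invgK.
have [C lC] : exists C, lf C != 0.
  apply: contrapT => nC; move/eqP: l0; apply; apply/val_inj/funext => x /=.
  by apply: contrapT => /eqP lx; apply: nC; exists x.
have lC0 : 0 < sqmod (lf C).
  rewrite lt_neqAle sqmod_ge0 andbT eq_sym; apply/eqP => /sqmod_eq0 lC1.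
  by rewrite lC1 eqxx in lC.
pose u : rep_space (quasi_regular R L') := modulus lf.
have uH h : H h -> rep_op h u = u.
  move=> Hh; apply/val_inj/funext => x /=; rewrite linv//; exact: subgroup_inv.
(* If [g] fixes [C], the term of [<g u, u>] at [C] is [|l C|^2 > 0], which [rip_translate_le0]
   excludes for [g] outside [H]. *)
have stab g : coset_act g C = C -> H g.
  move=> gC; apply: contrapT => nHg.
  have := rip_translate_le0 sH S0 SH k0 gap wc1 nHg uH.
  set f := fun x => (rep_op g u : ell2 R (cosets L')) x * ((u : ell2 R (cosets L')) x)^*%C.
  have ReE x : complex.Re (f x) = Num.sqrt (sqmod (lf (coset_act g^-1 x))) *
      Num.sqrt (sqmod (lf x)).
    by rewrite /f/= mul0r subr0.
  have [fin _] := ell2_ip_summable (rep_op g u : ell2 R (cosets L')) (u : ell2 R (cosets L')).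
  have Re0 x : 0 <= complex.Re (f x) by rewrite ReE mulr_ge0 ?sqrtr_ge0.
  have fin' : (nnsum (fun x => complex.Re (f x)) < +oo)%E.
    by apply: le_lt_trans fin; apply: le_nnsum => x; exact: ler_norm.
  have -> : rip (rep_op g u) u = fine (nnsum (fun x => complex.Re (f x))).
    by rewrite -ge0_rsum.
  rewrite -lee_fin fineK ?nnsum_fin// leNgt => /negP; apply.
  apply: lt_le_trans (nnsum_ge C Re0); rewrite lte_fin ReE.
  have -> : coset_act g^-1 C = C by rewrite -{1}gC -coset_actM mulVg coset_act1.
  by rewrite mulr_gt0 ?sqrtr_gt0.
pose O := [set coset_act h C | h in H].
have fO : finite_set O.
  by apply: (finite_level_set (v := lf) lC0) => _ [h Hh <-]; rewrite linv.
pose g0 := coset_rep C; have CE : C = mkcoset L' g0 by rewrite coset_repK.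
(* The stabilizer of [C = g0 L'] is [g0 L' g0^-1], so [stab] puts [L'] inside [g0^-1 H g0]. The
   cosets of [L'] there are the translates by [g0^-1] of the points of the finite orbit [O]. *)
have L'B : L' = lconj g0^-1 H.
  apply: finite_index_self_commensurating => //; first exact: lconj_subgroup.
    move=> y L'y; exists (g0 * y * g0^-1)%g.
      apply: stab; rewrite CE coset_act_mk; apply/(mkcosetP sL').
      by rewrite mulgVK invgM mulgVK; exact: subgroup_inv.
    by rewrite invgK !mulgA mulVg mul1g mulgVK.
  apply: (sub_finite_set _ (finite_image (fun x : cosets L' => lcoset g0^-1 (\val x)) fO)).
  move=> _ [_ [h Hh <-] <-]; exists (coset_act h C); first by exists h.
  by rewrite CE /= -!lcosetM invgK.
by exists (g0^-1)%g.
Qed.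

End Rigidity.

Theorem mainTheorem2 (R : realType) (L G : groupType)
    (iota : {multiplicative L -> G}) :
  countable [set: L] -> countable [set: G] ->
  ~ amenable R L -> bi_exact R L -> existential_embedding iota ->
  strongly_self_commensurating (range iota) /\
  (forall L' : set G, subgroup L' -> self_commensurating L' ->
     (weakly_equivalent (quasi_regular R (range iota)) (quasi_regular R L') <->
      conjugate (range iota) L')).
Proof.
move=> Lcount _ Lnam Lexact Lex; split.
  exact: (strongly_self_commensurating_range Lcount Lexact Lex Lnam).
move=> L' sL' cL'; split; last exact: conjugate_weakly_equivalent.
exact: (weakly_equivalent_conjugate Lcount Lexact Lex Lnam sL' cL').
Qed.
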